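(* Let $k$ be a finite field, $r\ge2$, and let $A$ be a finitely generated metabelian $F_r$-Lie algebra over $k$. Then the following are equivalent: (1) $A\in F_r\text{-}\mathrm{ucl}(F_r)$; (2) $A$ is a $\Phi'_r$-algebra; (3) $A$ is $F_r$-isomorphic to the algebra $F_r\oplus M$ for some torsion-free module $M$ over $R=k[x_1,\dots,x_r]$.
   Context: Lie products are left-normed. $F_n$ is the free metabelian Lie algebra over $k$ of rank $n$ with free base $a_1,\dots,a_n$; $\mathrm{Fit}(B)$ (Fitting radical) is the sum of all nilpotent ideals of $B$; $\mathrm{Fit}(F_n)=F_n^2$ is a module over $R_n=k[x_1,\dots,x_n]$ via $u\cdot x_i=ua_i$; $R=R_r$. An $F_r$-Lie algebra is a Lie algebra containing a designated copy of $F_r$; $F_r$-homomorphisms/isomorphisms are those restricting to the identity on $F_r$. $F_r\text{-}\mathrm{ucl}(F_r)$ is the class of $F_r$-Lie algebras satisfying all universal sentences, true in $F_r$, of the language $L_{F_r}$ (the language $L$ of Lie algebras over $k$ — symbols $0,+,-$, Lie product, scalar multiplication by each $\alpha\in k$ — enriched by constants for all elements of $F_r$). For a term $y$, $y\cdot f(t_1,\dots,t_n)$ means the Lie term where monomial $x_{i_1}\cdots x_{i_t}$ acts by $y\mapsto yt_{i_1}\cdots t_{i_t}$, extended linearly. Direct module extension: for a torsion-free $R$-module $M$, $F_r\oplus M$ is the Lie algebra on $F_r\oplus M$ with $F_r$ a subalgebra, $MM=0$, and $mu=-um=m\cdot(\sum\alpha_ix_i)$ for $m\in M$, $u\in F_r$,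 $u\equiv\sum\alpha_ia_i\bmod F_r^2$. Let $\mathrm{Fit}(x)\equiv\forall y\,(xyx=0)$, $\varphi(x_1,\dots,x_n)\equiv\bigwedge_{(\alpha_i)\in k^n\setminus\{0\}}\neg\mathrm{Fit}(\sum\alpha_ix_i)$. $\Phi'_r$ consists of: $\Phi1$: $\forall x_1..x_4\,(x_1x_2)(x_3x_4)=0$. $\Phi2$: $\forall x,y\,(xyx=0\wedge xyy=0\to xy=0)$. $\Phi3$: $\forall x,y,z\,(x\ne0\wedge xy=0\wedge xz=0\to yz=0)$. $\Phi4$: $\forall x_1..x_{r+1}\,\neg\varphi(x_1,\dots,x_{r+1})$. $\Phi'5$: for every nonzero $f\in R$: $\forall z_1,z_2\,((z_1z_2)\cdot f(a_1,\dots,a_r)=0\to z_1z_2=0)$. $\Phi6$: for every $n\le r$ and every nonzero $l(a_1,\dots,a_n)\in F_n$: $\forall x_1..x_n\,(\varphi(x_1..x_n)\to l(x_1..x_n)\ne0)$. $\Phi'7$: for every finite system $y_1f_{i1}+\dots+y_lf_{il}=c_i$ ($i=1..m$, $f_{ij}\in R$, $c_i\in\mathrm{Fit}(F_r)$) having no solution in $\mathrm{Fit}(F_r)$: $\forall y_1..y_l\,(\bigwedge_{j=1}^l\bigwedge_{i=1}^r y_ja_iy_j=0\to\bigvee_{i=1}^m h'_i\ne0)$, where $h'_i=\sum_j y_j\cdot f_{ij}(a_1,\dots,a_r)-c_i$. A $\Phi'_r$-algebra is an $F_r$-Lie algebra satisfying all of $\Phi'_r$. *)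

(* Defs.v *)
From HB Require Import structures.
From mathcomp Require Import all_boot all_algebra.
From mathcomp Require Import mpoly.
From Stdlib Require Import ClassicalEpsilon.

Set Implicit Arguments.
Unset Strict Implicit.
Unset Printing Implicit Defensive.

Import GRing.Theory.
Local Open Scope ring_scope.

Section LieDefs.

Variable k : fieldType.

Definition is_lie (L : lmodType k) (br : L -> L -> L) : Prop :=
  [/\ (forall (c : k) x y z, br (c *: x + y) z = c *: br x z + br y z),
      (forall (c : k) x y z, br z (c *: x + y) = c *: br z x + br z y),
      (forall x, br x x = 0) &
      (forall x y z, br (br x y) z + br (br y z) x + br (br z x) y = 0)].

Definition metabelian (L : lmodType k) (br : L -> L -> L) : Prop :=
  forall x1 x2 x3 x4, br (br x1 x2) (br x3 x4) = 0.

Definition is_lie_hom (L1 L2 : lmodType k) (br1 : L1 -> L1 -> L1)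
  (br2 : L2 -> L2 -> L2) (f : L1 -> L2) : Prop :=
  [/\ (forall x y, f (x + y) = f x + f y),
      (forall (c : k) x, f (c *: x) = c *: f x) &
      (forall x y, f (br1 x y) = br2 (f x) (f y))].

Definition generated_by (L : lmodType k) (br : L -> L -> L) (S : L -> Prop) :
  Prop :=
  forall P : L -> Prop,
    P 0 -> (forall x y, P x -> P y -> P (x + y)) ->
    (forall (c : k) x, P x -> P (c *: x)) ->
    (forall x y, P x -> P y -> P (br x y)) ->
    (forall x, S x -> P x) -> forall x, P x.

Definition fin_generated (L : lmodType k) (br : L -> L -> L) : Prop :=
  exists s : seq L, generated_by br (fun x => List.In x s).

Definition is_free_metabelian (r : nat) (F : lmodType k) (brF : F -> F -> F)
  (a : 'I_r -> F) : Prop :=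
  [/\ is_lie brF, metabelian brF,
      generated_by brF (fun x => exists i, x = a i) &
      forall (B : lmodType k) (brB : B -> B -> B), is_lie brB -> metabelian brB ->
        forall b : 'I_r -> B,
          exists phi : F -> B, is_lie_hom brF brB phi /\ forall i, phi (a i) = b i].

Definition in_square (L : lmodType k) (br : L -> L -> L) (u : L) : Prop :=
  exists s : seq (L * L), u = \sum_(p <- s) br p.1 p.2.

Inductive lterm (C : Type) : Type :=
  | LVar of nat
  | LCst of C
  | LZero
  | LAdd of lterm C & lterm C
  | LOpp of lterm C
  | LBr of lterm C & lterm C
  | LScal of k & lterm C.

Inductive qform (C : Type) : Type :=
  | QEq of lterm C & lterm C
  | QNot of qform C
  | QAnd of qform C & qform C
  | QOr of qform C & qform C.

Fixpoint eval_term (C : Type) (L : lmodType k) (br : L -> L -> L)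
  (cst : C -> L) (e : nat -> L) (t : lterm C) : L :=
  match t with
  | LVar n => e n
  | LCst c => cst c
  | LZero => 0
  | LAdd t1 t2 => eval_term br cst e t1 + eval_term br cst e t2
  | LOpp t1 => - eval_term br cst e t1
  | LBr t1 t2 => br (eval_term br cst e t1) (eval_term br cst e t2)
  | LScal c t1 => c *: eval_term br cst e t1
  end.

Fixpoint holds (C : Type) (L : lmodType k) (br : L -> L -> L)
  (cst : C -> L) (e : nat -> L) (f : qform C) : Prop :=
  match f with
  | QEq t1 t2 => eval_term br cst e t1 = eval_term br cst e t2
  | QNot g => ~ holds br cst e g
  | QAnd g h => holds br cst e g /\ holds br cst e h
  | QOr g h => holds br cst e g \/ holds br cst e h
  end.

Definition univ_holds (C : Type) (L : lmodType k) (br : L -> L -> L)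
  (cst : C -> L) (f : qform C) : Prop :=
  forall e : nat -> L, holds br cst e f.

Definition in_ucl (F : lmodType k) (brF : F -> F -> F)
  (A : lmodType k) (brA : A -> A -> A) (iota : F -> A) : Prop :=
  forall f : qform F, univ_holds brF id f -> univ_holds brA iota f.

Fixpoint vars_below (C : Type) (n : nat) (t : lterm C) : Prop :=
  match t with
  | LVar j => (j < n)%N
  | LCst _ => True
  | LZero => True
  | LAdd t1 t2 => vars_below n t1 /\ vars_below n t2
  | LOpp t1 => vars_below n t1
  | LBr t1 t2 => vars_below n t1 /\ vars_below n t2
  | LScal _ t1 => vars_below n t1
  end.

Definition env_of (L : lmodType k) (n : nat) (x : 'I_n -> L) : nat -> L :=
  fun j => if insub j is Some i then x i else 0.

(* The action  y . f(t_1,...,t_r)  for f in R = k[x_1..x_r]: the      *)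
(* monomial x_1^m1 ... x_r^mr acts by y |-> y t_1 ... t_1 ... t_r ..t_r *)
(* (left-normed, m_i copies of t_i, indices in increasing order).      *)

Definition mono_act (r : nat) (L : lmodType k) (br : L -> L -> L)
  (y : L) (m : 'X_{1..r}) (t : 'I_r -> L) : L :=
  foldl (fun z i => iter (m i) (fun w => br w (t i)) z) y (enum 'I_r).

Definition poly_act (r : nat) (L : lmodType k) (br : L -> L -> L)
  (y : L) (f : {mpoly k[r]}) (t : 'I_r -> L) : L :=
  \sum_(m <- msupp f) f@_m *: mono_act br y m t.

Definition FitEl (L : lmodType k) (br : L -> L -> L) (x : L) : Prop :=
  forall y, br (br x y) x = 0.

Definition varphi (L : lmodType k) (br : L -> L -> L) (n : nat)
  (x : 'I_n -> L) : Prop :=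
  forall alpha : 'I_n -> k, (exists i, alpha i != 0) ->
    ~ FitEl br (\sum_(i < n) alpha i *: x i).

Section Phi.
Variables (r : nat) (F : lmodType k) (brF : F -> F -> F) (a : 'I_r -> F)
  (A : lmodType k) (brA : A -> A -> A) (iota : F -> A).

Definition Phi1 : Prop := forall x1 x2 x3 x4, brA (brA x1 x2) (brA x3 x4) = 0.

Definition Phi2 : Prop :=
  forall x y, brA (brA x y) x = 0 -> brA (brA x y) y = 0 -> brA x y = 0.

Definition Phi3 : Prop :=
  forall x y z, x <> 0 -> brA x y = 0 -> brA x z = 0 -> brA y z = 0.

Definition Phi4 : Prop := forall x : 'I_r.+1 -> A, ~ varphi brA x.

Definition Phi'5 : Prop :=
  forall f : {mpoly k[r]}, f != 0 -> forall z1 z2 : A,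
    poly_act brA (brA z1 z2) f (fun i => iota (a i)) = 0 -> brA z1 z2 = 0.

(* elements of F_n (n <= r) are the values l(a_1,...,a_n) of Lie terms l
   (without constants) in n variables; F_n is the subalgebra of F_r
   generated by a_1, ..., a_n *)
Definition Phi6 : Prop :=
  forall (n : nat) (Hn : (n <= r)%N) (l : lterm Empty_set),
    vars_below n l ->
    eval_term brF (fun c : Empty_set => match c with end)
      (env_of (fun i : 'I_n => a (widen_ord Hn i))) l <> 0 ->
    forall x : 'I_n -> A, varphi brA x ->
      eval_term brA (fun c : Empty_set => match c with end) (env_of x) l <> 0.

Definition Phi'7 : Prop :=
  forall (m l : nat) (f : 'I_m -> 'I_l -> {mpoly k[r]}) (c : 'I_m -> F),
    (forall i, in_square brF (c i)) ->
    ~ (exists y : 'I_l -> F, and (forall j, in_square brF (y j))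
         (forall i, \sum_(j < l) poly_act brF (y j) (f i j) a = c i)) ->
    forall y : 'I_l -> A,
      (forall j (i : 'I_r), brA (brA (y j) (iota (a i))) (y j) = 0) ->
      exists i, \sum_(j < l) poly_act brA (y j) (f i j) (fun i0 => iota (a i0))
                  - iota (c i) <> 0.

Definition Phi'_algebra : Prop :=
  [/\ Phi1, Phi2, Phi3, Phi4 & Phi'5] /\ Phi6 /\ Phi'7.

End Phi.

Definition lin_coef (r : nat) (F : lmodType k) (brF : F -> F -> F)
  (a : 'I_r -> F) (u : F) : 'I_r -> k :=
  epsilon (inhabits (fun _ => 0))
    (fun alpha : 'I_r -> k => in_square brF (u - \sum_(i < r) alpha i *: a i)).

Definition lin_form (r : nat) (F : lmodType k) (brF : F -> F -> F)
  (a : 'I_r -> F) (u : F) : {mpoly k[r]} :=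
  \sum_(i < r) (lin_coef brF a u i)%:MP * 'X_i.

Definition torsion_free (r : nat) (M : lmodType {mpoly k[r]}) : Prop :=
  forall (f : {mpoly k[r]}) (m : M), f != 0 -> f *: m = 0 -> m = 0.

Definition dme_br (r : nat) (F : lmodType k) (brF : F -> F -> F)
  (a : 'I_r -> F) (M : lmodType {mpoly k[r]}) (p q : F * M) : F * M :=
  (brF p.1 q.1, lin_form brF a q.1 *: p.2 - lin_form brF a p.1 *: q.2).

(* phi : F_r (+) M -> A is an F_r-isomorphism of Lie algebras
   (k acts on M through k -> R, c |-> c%:MP) *)
Definition is_Fr_iso (r : nat) (F : lmodType k) (brF : F -> F -> F)
  (a : 'I_r -> F) (M : lmodType {mpoly k[r]})
  (A : lmodType k) (brA : A -> A -> A) (iota : F -> A) (phi : F * M -> A) :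
  Prop :=
  [/\ bijective phi,
      (forall p q, phi (p.1 + q.1, p.2 + q.2) = phi p + phi q),
      (forall (c : k) p, phi (c *: p.1, c%:MP *: p.2) = c *: phi p),
      (forall p q, phi (dme_br brF a p q) = brA (phi p) (phi q)) &
      (forall u, phi (u, 0) = iota u)].

End LieDefs.

(* Main.v *)
(* (1) => (2): every axiom of Phi'_r is a universal sentence (k being finite),
   so it suffices to check it in F. The Magnus embedding of F into k^r + R^r,
   a_i |-> (e_i, e_i), turns all of them into linear algebra over R; it is
   injective because F^2 is generated over R by the [a_i, a_j], and collecting
   the smallest variable with the Jacobi identity gives a left inverse.
   (2) => (3): the axioms make Fit(A) an abelian, torsion-free, finitely
   generated R-module with A = sum k a_i + Fit(A); since R is Noetherian, Phi'7
   makes F^2 a direct summand of Fit(A), and M is a complement.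
   (3) => (1): a finitely generated torsion-free M has a nonzero multiple
   dM contained in a free module, so sending a generic linear form into
   [a_i, a_j] . R separates any finite set of elements of F + M by
   F-homomorphisms to F. *)
Require Import Defs.
From HB Require Import structures.
From mathcomp Require Import all_boot all_order all_algebra.
From mathcomp Require ssrcomplements.
From mathcomp Require Import mpoly.
From mathcomp Require Import ring.
From Stdlib Require Import Classical ClassicalEpsilon.

Set Implicit Arguments.
Unset Strict Implicit.
Unset Printing Implicit Defensive.

Import Order.TTheory GRing.Theory.
Local Open Scope ring_scope.
(** * Lie brackets and the action of polynomials *)

(** Finiteness of k serves [varphi], a conjunction over all coefficient vectors: every conjunct
    denies a Fit condition and needs its own witness variable, and a quantifier-free formula has
    room for finitely many. For the converse it is an obstacle: k has too few scalars for generic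
    coefficients, so powers of a variable of R are used instead. The condition r >= 2 means that F^2
    is nonzero; a nonzero w in F^2 detects linear parts, because bracketing w with u multiplies it
    by the linear form of u and R is a domain. The splitting of Fit(A) is a purity argument: [Phi'7]
    says that a finite linear system over R with right-hand sides in F^2 which is solvable in Fit(A)
    is solvable in F^2. Purity splits once the quotient is finitely presented, hence the need for
    finitely many generators and for finitely many relations. *)

Lemma List_In_mem (T : eqType) (x : T) (s : seq T) : List.In x s -> x \in s.
Proof. by elim: s => //= y s IH [->|/IH]; rewrite in_cons ?eqxx // => ->; rewrite orbT. Qed.

Lemma mem_List_In (T : eqType) (x : T) (s : seq T) : x \in s -> List.In x s.
Proof. by elim: s => //= y s IH; rewrite in_cons => /predU1P[->|/IH]; [left | right]. Qed.

Section Lie.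

Variables (k : fieldType) (L : lmodType k) (br : L -> L -> L).
Hypothesis brP : is_lie br.

Lemma br0l x : br 0 x = 0.
Proof.
by case: brP => H _ _ _; have := H (-1) 0 0 x; rewrite scaler0 addr0 scaleN1r addNr.
Qed.

Lemma br0r x : br x 0 = 0.
Proof.
by case: brP => _ H _ _; have := H (-1) 0 0 x; rewrite scaler0 addr0 scaleN1r addNr.
Qed.

Lemma brDl x y z : br (x + y) z = br x z + br y z.
Proof. by case: brP => H _ _ _; have := H 1 x y z; rewrite !scale1r. Qed.

Lemma brDr x y z : br z (x + y) = br z x + br z y.
Proof. by case: brP => _ H _ _; have := H 1 x y z; rewrite !scale1r. Qed.

Lemma brZl c x z : br (c *: x) z = c *: br x z.
Proof. by case: brP => H _ _ _; have := H c x 0 z; rewrite !addr0 br0l addr0. Qed.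

Lemma brZr c x z : br z (c *: x) = c *: br z x.
Proof. by case: brP => _ H _ _; have := H c x 0 z; rewrite !addr0 br0r addr0. Qed.

Lemma brNl x z : br (- x) z = - br x z.
Proof. by rewrite -scaleN1r brZl scaleN1r. Qed.

Lemma br_suml (I : Type) (s : seq I) (P : pred I) (G : I -> L) z :
  br (\sum_(i <- s | P i) G i) z = \sum_(i <- s | P i) br (G i) z.
Proof.
by apply: (big_morph (br^~ z)) => [x y|]; [apply: brDl | apply: br0l].
Qed.

Lemma br_sumr (I : Type) (s : seq I) (P : pred I) (G : I -> L) z :
  br z (\sum_(i <- s | P i) G i) = \sum_(i <- s | P i) br z (G i).
Proof.
by apply: (big_morph (br z)) => [x y|]; [apply: brDr | apply: br0r].
Qed.

Lemma brxx x : br x x = 0.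
Proof. by case: brP. Qed.

Lemma brC x y : br x y = - br y x.
Proof.
apply/eqP; rewrite -addr_eq0; apply/eqP.
by have := brxx (x + y); rewrite brDl !brDr !brxx add0r addr0.
Qed.

(** Jacobi in derivation form: when [br x (br y z)] vanishes, the last two factors of a left-normed
    product commute. *)
Lemma br_swap x y z : br (br x y) z = br (br x z) y + br x (br y z).
Proof.
case: brP => _ _ _ /(_ x y z) /eqP; rewrite -addrA addr_eq0 => /eqP ->.
by rewrite opprD -(brC x) (brC z x) brNl opprK addrC.
Qed.

Lemma in_square0 : in_square br 0.
Proof. by exists [::]; rewrite big_nil. Qed.

Lemma in_squareD u v : in_square br u -> in_square br v -> in_square br (u + v).
Proof. by move=> [s ->] [t ->]; exists (s ++ t); rewrite big_cat. Qed.

Lemma in_squareZ c u : in_square br u -> in_square br (c *: u).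
Proof.
move=> [s ->]; exists [seq (c *: p.1, p.2) | p <- s].
by rewrite big_map scaler_sumr; apply: eq_bigr => p _; rewrite brZl.
Qed.

Lemma in_square_br u v : in_square br (br u v).
Proof. by exists [:: (u, v)]; rewrite big_seq1. Qed.

Lemma in_square_sum (I : Type) (s : seq I) (P : pred I) (G : I -> L) :
  (forall i, P i -> in_square br (G i)) -> in_square br (\sum_(i <- s | P i) G i).
Proof.
by move=> H; elim/big_ind: _ => //; [apply: in_square0 | apply: in_squareD].
Qed.

Lemma metabelian_square u v :
  metabelian br -> in_square br u -> in_square br v -> br u v = 0.
Proof.
move=> m [s ->] [t ->]; rewrite br_suml big1 // => p _.
by rewrite br_sumr big1 // => q _; apply: m.
Qed.

End Lie.

(** * Linear extension from monomials to polynomials *)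

Section LinearExtension.

Variables (k : fieldType) (r : nat) (L : lmodType k).
Implicit Types (phi : 'X_{1..r} -> L) (f g : {mpoly k[r]}).

(** [poly_act] unfolds to [lext] of [mono_act], so linearity in the polynomial is proved once, for
    [contract] as well. *)
Definition lext phi f : L := \sum_(m <- msupp f) f@_m *: phi m.

Lemma lextE phi f d : (msize f <= d)%N ->
  lext phi f = \sum_(m : 'X_{1..r < d}) f@_m *: phi m.
Proof.
move=> le_fd; set I : subFinType _ := 'X_{1..r < d}.
rewrite /lext (ssrcomplements.big_mksub I) ?msupp_uniq //=; first last.
  by move=> x /msize_mdeg_lt /leq_trans; apply.
by rewrite big_rmcond //= => j /memN_msupp_eq0 ->; rewrite scale0r.
Qed.

Lemma lextD phi f g : lext phi (f + g) = lext phi f + lext phi g.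
Proof.
pose d := (msize f + msize g + msize (f + g))%N.
rewrite !(@lextE _ _ d) /d ?leq_addl //; first last.
- by rewrite -addnA leq_addr.
- by rewrite addnAC leq_addl.
by rewrite -big_split; apply: eq_bigr => m _; rewrite mcoeffD scalerDl.
Qed.

Lemma lextZ phi c f : lext phi (c *: f) = c *: lext phi f.
Proof.
pose d := (msize f + msize (c *: f))%N.
rewrite !(@lextE _ _ d) /d ?leq_addl ?leq_addr // scaler_sumr.
by apply: eq_bigr => m _; rewrite mcoeffZ scalerA.
Qed.

Lemma lext0 phi : lext phi 0 = 0.
Proof. by rewrite /lext msupp0 big_nil. Qed.

Lemma lextX phi m : lext phi 'X_[m] = phi m.
Proof. by rewrite /lext msuppX big_seq1 mcoeffX eqxx scale1r. Qed.

Lemma lext_ind (P : {mpoly k[r]} -> Prop) :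
  P 0 -> (forall f g, P f -> P g -> P (f + g)) ->
  (forall c f, P f -> P (c *: f)) -> (forall m, P 'X_[m]) -> forall f, P f.
Proof. by move=> P0 PD PZ PX; elim/mpolyind => // c m p _ _ Pp; apply/PD/Pp/PZ/PX. Qed.

End LinearExtension.

(* [y . f] makes sense as a module action only on a subspace [V] that is
   stable under the [t i] and on which the [t i] act by commuting maps. *)
Definition act_closed (k : fieldType) (r : nat) (L : lmodType k)
    (br : L -> L -> L) (t : 'I_r -> L) (V : L -> Prop) : Prop :=
  [/\ V 0, (forall x y, V x -> V y -> V (x + y)),
      (forall (c : k) x, V x -> V (c *: x)),
      (forall x i, V x -> V (br x (t i))) &
      (forall x i j, V x -> br (br x (t i)) (t j) = br (br x (t j)) (t i))].

Section Action.

Variables (k : fieldType) (r : nat) (L : lmodType k) (br : L -> L -> L).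
Variables (t : 'I_r -> L).
Hypothesis brP : is_lie br.

Local Notation mact y m := (mono_act br y m t).
Local Notation pact y f := (poly_act br y f t).

Let step (m : 'X_{1..r}) z i := iter (m i) (fun w => br w (t i)) z.

Lemma mono_actD m x y : mact (x + y) m = mact x m + mact y m.
Proof.
rewrite /mono_act; elim: (enum _) x y => //= i s IH x y; rewrite -IH; congr foldl.
by elim: (m i) => //= n ->; rewrite brDl.
Qed.

Lemma mono_actZ m c x : mact (c *: x) m = c *: mact x m.
Proof.
rewrite /mono_act; elim: (enum _) x => //= i s IH x; rewrite -IH; congr foldl.
by elim: (m i) => //= n ->; rewrite brZl.
Qed.

Lemma mono_actN m x : mact (- x) m = - mact x m.
Proof. by rewrite -scaleN1r mono_actZ scaleN1r. Qed.

Lemma mono_act_m0 x : mact x 0%MM = x.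
Proof. by rewrite /mono_act; elim: (enum _) x => //= i s IH x; rewrite mnm0E IH. Qed.

Lemma mono_actU x i : mact x U_(i)%MM = br x (t i).
Proof.
have : uniq (enum 'I_r) by apply: enum_uniq.
have : i \in enum 'I_r by rewrite mem_enum.
rewrite /mono_act; elim: (enum _) x => //= j s IH x.
rewrite in_cons mnm1E; case: (eqVneq i j) => [<- _ /= /andP[nis _]|_ /= si /andP[_ us]].
  elim: s nis {IH} (br x (t i)) => //= l s IH.
  by rewrite in_cons negb_or mnm1E => /andP[/negPf -> /IH].
exact: IH.
Qed.

Lemma mono_act0 m : mact 0 m = 0.
Proof. by have := mono_actZ m 0 0; rewrite !scale0r. Qed.

Lemma poly_actDl f x y : pact (x + y) f = pact x f + pact y f.
Proof. by rewrite -big_split; apply: eq_bigr => m _; rewrite mono_actD scalerDr. Qed.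

Lemma poly_actZl f c x : pact (c *: x) f = c *: pact x f.
Proof.
rewrite /poly_act scaler_sumr; apply: eq_bigr => m _.
by rewrite mono_actZ !scalerA mulrC.
Qed.

Lemma poly_act0l f : pact 0 f = 0.
Proof. by have := poly_actZl f 0 0; rewrite !scale0r. Qed.

Lemma poly_actNl f x : pact (- x) f = - pact x f.
Proof. by rewrite -scaleN1r poly_actZl scaleN1r. Qed.

Lemma poly_act_suml (I : Type) (s : seq I) (P : pred I) (G : I -> L) f :
  pact (\sum_(i <- s | P i) G i) f = \sum_(i <- s | P i) pact (G i) f.
Proof.
by apply: (big_morph (fun y => pact y f)) => [x y|]; [apply: poly_actDl | apply: poly_act0l].
Qed.

Lemma poly_actDr x f g : pact x (f + g) = pact x f + pact x g.
Proof. exact: lextD. Qed.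

Lemma poly_actZr x c f : pact x (c *: f) = c *: pact x f.
Proof. exact: lextZ. Qed.

Lemma poly_act0r x : pact x 0 = 0.
Proof. exact: lext0. Qed.

Lemma poly_actNr x f : pact x (- f) = - pact x f.
Proof. by have := poly_actZr x (-1) f; rewrite !scaleN1r. Qed.

Lemma poly_actX x m : pact x 'X_[m] = mact x m.
Proof. exact: lextX. Qed.

Lemma poly_actXi x i : pact x 'X_i = br x (t i).
Proof. by rewrite poly_actX mono_actU. Qed.

Lemma poly_act1 x : pact x 1 = x.
Proof. by rewrite -mpolyX0 poly_actX mono_act_m0. Qed.

Lemma poly_actC x c : pact x c%:MP = c *: x.
Proof. by rewrite -[c%:MP]mulr1 mul_mpolyC poly_actZr poly_act1. Qed.

Lemma poly_act_sumr (I : Type) (s : seq I) (P : pred I) x (G : I -> {mpoly k[r]}) :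
  pact x (\sum_(i <- s | P i) G i) = \sum_(i <- s | P i) pact x (G i).
Proof.
by apply: (big_morph (fun f => pact x f)) => [f g|]; [apply: poly_actDr | apply: poly_act0r].
Qed.

Variable V : L -> Prop.
Hypothesis VP : act_closed br t V.

Lemma mono_act_closed m x : V x -> V (mact x m).
Proof.
case: VP => _ _ _ Vbr _; rewrite /mono_act; elim: (enum _) x => //= i s IH x Vx.
by apply: IH; elim: (m i) => //= n; apply: Vbr.
Qed.

Lemma poly_act_closed f x : V x -> V (pact x f).
Proof.
case: VP => V0 VD VZ _ _ Vx; rewrite /poly_act; elim/big_ind: _ => // m _.
exact/VZ/mono_act_closed.
Qed.

Lemma mono_act_br m x i : V x -> mact (br x (t i)) m = br (mact x m) (t i).
Proof.
case: VP => _ _ _ Vbr Vc; rewrite /mono_act; elim: (enum _) x => //= j s IH x Vx.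
have [Vj e] : V (step m x j) /\ step m (br x (t i)) j = br (step m x j) (t i).
  rewrite /step; elim: (m j) => //= n [Vn ->]; split; first exact: Vbr.
  by rewrite Vc.
by rewrite -/(step m _ j) e IH.
Qed.

(** [mono_act] applies the variables in a fixed order, so the extra factor has to travel to the
    block of [i]; commutation on [V] allows this. *)
Lemma mono_act_mulU m x i : V x -> mact x (m + U_(i))%MM = br (mact x m) (t i).
Proof.
move=> Vx; have Vc := let: And5 _ _ _ _ Vc := VP in Vc.
have Vbr := let: And5 _ _ _ Vbr _ := VP in Vbr.
rewrite -mono_act_br //.
have : uniq (enum 'I_r) by apply: enum_uniq.
have : i \in enum 'I_r by rewrite mem_enum.
rewrite /mono_act; elim: (enum _) x Vx => //= j s IH x Vx.
have sw y n : V y -> iter n (fun w => br w (t j)) (br y (t i)) =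
    br (iter n (fun w => br w (t j)) y) (t i) /\ V (iter n (fun w => br w (t j)) y).
  by move=> Vy; elim: n => //= n [-> Vn]; split; [rewrite Vc | apply: Vbr].
rewrite in_cons mnmDE mnm1E; case: (eqVneq i j) => [ij _ /= /andP[nis _]|_ /= si /andP[_ us]].
  rewrite addn1 iterSr ij; elim: s nis {IH} (iter _ _ _) => //= l s IH.
  by rewrite in_cons negb_or mnmDE mnm1E => /andP[/negPf -> /IH] H z; rewrite addn0 H.
by rewrite addn0 IH //; [rewrite (sw _ _ Vx).1 | apply: (sw _ _ Vx).2].
Qed.

(** Quantifying over [P] inside the induction lets a sum of monomials be handled through a
    translated predicate. *)
Lemma mnm_rect_U (P : 'X_{1..r} -> Prop) :
  P 0%MM -> (forall m i, P m -> P (m + U_(i))%MM) -> forall m, P m.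
Proof.
move=> P0 PU m; rewrite [m]multinomUE_id.
elim/big_ind: _ P P0 PU => [//|x y Hx Hy P P0 PU|i _ P P0 PU].
  apply: (Hy (fun y => P (x + y)%MM)); first by rewrite addm0; apply: Hx.
  by move=> m' i; rewrite addmA; apply: PU.
elim: (m i) => [|n IH]; first by rewrite mulm0n.
by rewrite mulmSr; apply: PU.
Qed.

Lemma mono_act_add x m m' : V x -> mact x (m + m')%MM = mact (mact x m) m'.
Proof.
move=> Vx; elim/mnm_rect_U: m' => [|m' i IH]; first by rewrite addm0 mono_act_m0.
rewrite addmA !mono_act_mulU ?IH //; exact: mono_act_closed.
Qed.

Lemma poly_actM x f g : V x -> pact x (f * g) = pact (pact x f) g.
Proof.
move=> Vx; elim/lext_ind: g => [|g h Hg Hh|c g Hg|m].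
- by rewrite mulr0 !poly_act0r.
- by rewrite mulrDr !poly_actDr Hg Hh.
- by rewrite -scalerAr !poly_actZr Hg.
elim/lext_ind: f => [|g h Hg Hh|c g Hg|m'].
- by rewrite mul0r !poly_act0r poly_act0l.
- by rewrite mulrDl !poly_actDr poly_actDl Hg Hh.
- by rewrite -scalerAl !poly_actZr poly_actZl Hg.
by rewrite -mpolyXD !poly_actX mono_act_add.
Qed.

Lemma poly_act_br x f i : V x -> br (pact x f) (t i) = pact x (f * 'X_i).
Proof. by move=> Vx; rewrite poly_actM // poly_actXi. Qed.

Lemma poly_act_brl x f i : V x -> pact (br x (t i)) f = br (pact x f) (t i).
Proof. by move=> Vx; rewrite poly_act_br // mulrC poly_actM // poly_actXi. Qed.

Lemma br_lin x (alpha : 'I_r -> k) :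
  br x (\sum_i alpha i *: t i) = pact x (\sum_i (alpha i)%:MP * 'X_i).
Proof.
rewrite br_sumr // poly_act_sumr; apply: eq_bigr => i _.
by rewrite brZr // mul_mpolyC poly_actZr poly_actXi.
Qed.

End Action.

Section ActionHom.

Variables (k : fieldType) (L1 L2 : lmodType k).
Variables (br1 : L1 -> L1 -> L1) (br2 : L2 -> L2 -> L2) (h : L1 -> L2).
Hypothesis hP : is_lie_hom br1 br2 h.

Lemma lie_hom0 : h 0 = 0.
Proof. by case: hP => _ H _; have := H 0 0; rewrite !scale0r. Qed.

Lemma lie_homN x : h (- x) = - h x.
Proof. by case: hP => _ H _; rewrite -scaleN1r H scaleN1r. Qed.

Lemma lie_homB x y : h (x - y) = h x - h y.
Proof. by case: hP => H _ _; rewrite H lie_homN. Qed.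

Lemma lie_hom_sum (I : Type) (s : seq I) (P : pred I) (G : I -> L1) :
  h (\sum_(i <- s | P i) G i) = \sum_(i <- s | P i) h (G i).
Proof. by case: hP => H _ _; apply: (big_morph h H lie_hom0). Qed.

Lemma lie_hom_square u : in_square br1 u -> in_square br2 (h u).
Proof.
case: hP => _ _ H [s ->]; exists [seq (h p.1, h p.2) | p <- s].
by rewrite lie_hom_sum big_map; apply: eq_bigr => p _; rewrite H.
Qed.

Lemma lie_hom_poly_act r (t : 'I_r -> L1) y f :
  h (poly_act br1 y f t) = poly_act br2 (h y) f (fun i => h (t i)).
Proof.
case: (hP) => _ HZ Hb; rewrite lie_hom_sum; apply: eq_bigr => m _; rewrite HZ; congr (_ *: _).
rewrite /mono_act; elim: (enum _) y => //= i s IH y; rewrite IH; congr foldl.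
by elim: (m i) => //= n <-; rewrite Hb.
Qed.

End ActionHom.

Lemma metabelian_act_closed (k : fieldType) (r : nat) (L : lmodType k) (br : L -> L -> L)
    (t : 'I_r -> L) :
  is_lie br -> metabelian br -> act_closed br t (in_square br).
Proof.
move=> brP m; split.
- exact: in_square0.
- exact: in_squareD.
- exact: in_squareZ.
- by move=> x i _; apply: in_square_br.
move=> x i j Vx; rewrite br_swap // [X in _ + X](metabelian_square brP m Vx) ?addr0 //.
exact: in_square_br.
Qed.

Lemma sum_delta (k : pzRingType) (V : lmodType k) (I : finType) (j : I) (G : I -> V) :
  \sum_i ((i == j)%:R : k) *: G i = G j.
Proof.
rewrite (bigD1 j) //= eqxx scale1r big1 ?addr0 // => i /negPf ->.
by rewrite scale0r.
Qed.

(* If [N] is an abelian ideal containing the brackets of the [t i], the sums of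
   a linear combination of the [t i] and an element of [N] form a subalgebra. *)
Lemma generated_decomp (k : fieldType) (r : nat) (L : lmodType k) (br : L -> L -> L)
    (t : 'I_r -> L) (N S : L -> Prop) :
  is_lie br -> N 0 -> (forall x y, N x -> N y -> N (x + y)) ->
  (forall (c : k) x, N x -> N (c *: x)) -> (forall x i, N x -> N (br x (t i))) ->
  (forall x y, N x -> N y -> br x y = 0) -> (forall i j, N (br (t i) (t j))) ->
  generated_by br S ->
  (forall x, S x -> exists (al : 'I_r -> k) n, N n /\ x = \sum_i al i *: t i + n) ->
  forall x, exists (al : 'I_r -> k) n, N n /\ x = \sum_i al i *: t i + n.
Proof.
move=> brP N0 ND NZ Nbr Nab Nt gen HS.
have Nsum (I : finType) (G : I -> L) : (forall i, N (G i)) -> N (\sum_i G i).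
  by move=> H; elim/big_ind: _.
have Nlin n (al : 'I_r -> k) : N n -> N (br n (\sum_i al i *: t i)).
  by move=> Nn; rewrite br_sumr //; apply: Nsum => i; rewrite brZr //; apply/NZ/Nbr.
have expand x n y m : N n -> N m ->
    br (x + n) (y + m) = br x y - br m x + br n y.
  move=> Nn Nm; rewrite (brDl brP) !(brDr brP) (brC brP x m).
  by rewrite (Nab n m) // addr0.
apply: (gen (fun x => exists (al : 'I_r -> k) n, N n /\ x = \sum_i al i *: t i + n)) => //.
- exists (fun=> 0), 0; split=> //.
  by rewrite addr0 big1 // => i _; rewrite scale0r.
- move=> _ _ [al [n [Nn ->]]] [be [m [Nm ->]]].
  exists (fun i => al i + be i), (n + m); split; first exact: ND.
  rewrite addrACA -big_split; congr (_ + _).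
  by apply: eq_bigr => i _; rewrite scalerDl.
- move=> c _ [al [n [Nn ->]]]; exists (fun i => c * al i), (c *: n); split; first exact: NZ.
  rewrite scalerDr scaler_sumr; congr (_ + _).
  by apply: eq_bigr => i _; rewrite scalerA.
move=> _ _ [al [n [Nn ->]]] [be [m [Nm ->]]].
set x := \sum_i _; set y := \sum_i _.
exists (fun=> 0), (br (x + n) (y + m)); split; last first.
  by rewrite big1 ?add0r // => i _; rewrite scale0r.
rewrite expand //; apply: (ND); last exact: Nlin.
apply: ND; last by rewrite -scaleN1r; apply/NZ/Nlin.
rewrite /x br_suml //; apply: (Nsum) => i; rewrite /y br_sumr //; apply: Nsum => j.
by rewrite brZl // brZr //; apply/NZ/NZ.
Qed.

Lemma act_closed_module (k : fieldType) (r : nat) (L : lmodType k) (br : L -> L -> L)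
    (t : 'I_r -> L) (V : L -> Prop) :
  is_lie br -> act_closed br t V ->
  exists (M : lmodType {mpoly k[r]}) (v : M -> L),
    [/\ injective v, forall m, V (v m), forall x, V x -> exists m, v m = x,
        forall m n, v (m + n) = v m + v n &
        forall f m, v (f *: m) = poly_act br (v m) f t].
Proof.
move=> brP VP; have [V0 VD VZ _ _] := VP.
(* A classical decision of [V] gives a boolean predicate, whose subtype has an injective [val]; the
   module laws then reduce to laws in [L]. *)
pose P x : bool := if excluded_middle_informative (V x) then true else false.
have PV x : P x -> V x by rewrite /P; case: excluded_middle_informative.
have VPb x : V x -> P x by rewrite /P; case: excluded_middle_informative.
pose T := {x : L | P x}.
have P0 : P 0 by apply: VPb.
have PD (x y : T) : P (val x + val y) by apply/VPb/VD; apply: PV; apply: valP.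
have PN (x : T) : P (- val x).
  by apply: VPb; rewrite -scaleN1r; apply: VZ; apply: PV; apply: valP.
have PZ f (x : T) : P (poly_act br (val x) f t).
  by apply: VPb; apply: (poly_act_closed VP); apply: PV; apply: valP.
pose zero : T := Sub 0 P0; pose add (x y : T) : T := Sub _ (PD x y).
pose opp (x : T) : T := Sub _ (PN x); pose scale f (x : T) : T := Sub _ (PZ f x).
have addA : associative add by move=> x y z; apply: val_inj; rewrite /= addrA.
have addC : commutative add by move=> x y; apply: val_inj; rewrite /= addrC.
have add0 : left_id zero add by move=> x; apply: val_inj; rewrite /= add0r.
have addN : left_inverse zero opp add by move=> x; apply: val_inj; rewrite /= addNr.
pose Z : zmodType := HB.pack T (GRing.isZmodule.Build T addA addC add0 addN).
have scaleA (f g : {mpoly k[r]}) (x : Z) : scale f (scale g x) = scale (f * g) x.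
  by apply: val_inj; rewrite /= mulrC (poly_actM brP VP) //; apply/PV/valP.
have scale1 : left_id 1 (scale : {mpoly k[r]} -> Z -> Z).
  by move=> x; apply: val_inj; rewrite /= poly_act1.
have scaleDr : right_distributive (scale : {mpoly k[r]} -> Z -> Z) +%R.
  by move=> f x y; apply: val_inj; rewrite /= poly_actDl.
have scaleDl (x : Z) : {morph (fun f : {mpoly k[r]} => scale f x : Z) : f g / f + g}.
  by move=> f g; apply: val_inj; rewrite /= poly_actDr.
pose M : lmodType {mpoly k[r]} := HB.pack Z
  (GRing.Zmodule_isLmodule.Build _ Z scaleA scale1 scaleDr scaleDl).
exists M, (val : T -> L); split=> //; first exact: val_inj.
- by move=> m; apply/PV/valP.
by move=> x /VPb Px; exists (Sub x Px).
Qed.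

(** * Noetherianity of polynomial rings *)

Section Span.

Variables (R : nzRingType) (V : lmodType R).

Definition submodule (P : V -> Prop) : Prop :=
  P 0 /\ forall a x y, P x -> P y -> P (a *: x + y).

Definition span (s : seq V) (x : V) : Prop :=
  forall P, submodule P -> (forall y, y \in s -> P y) -> P x.

Lemma span_submodule s : submodule (span s).
Proof.
split=> [P [] //|a x y Hx Hy P HP Ps].
by have [_ PD] := HP; apply: PD; [apply: Hx | apply: Hy].
Qed.

Lemma mem_span s x : x \in s -> span s x.
Proof. by move=> sx P _; apply. Qed.

Lemma submoduleB (P : V -> Prop) x y : submodule P -> P x -> P y -> P (x - y).
Proof.
by case=> _ PD Px Py; rewrite addrC -scaleN1r; apply: PD.
Qed.

Lemma submoduleZ (P : V -> Prop) a x : submodule P -> P x -> P (a *: x).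
Proof. by case=> P0 PD Px; rewrite -[_ *: x]addr0; apply: PD. Qed.

Lemma submoduleD (P : V -> Prop) x y : submodule P -> P x -> P y -> P (x + y).
Proof. by case=> P0 PD Px Py; rewrite -[x]scale1r; apply: PD. Qed.

Lemma submodule_sum (P : V -> Prop) (I : Type) (s : seq I) (Q : pred I) (G : I -> V) :
  submodule P -> (forall i, Q i -> P (G i)) -> P (\sum_(i <- s | Q i) G i).
Proof.
move=> Psub PG; elim/big_ind: _ => [|x y|i /PG] //; first by case: Psub.
exact: submoduleD.
Qed.

Lemma span_sum s x : span s x -> exists g : 'I_(size s) -> R, x = \sum_i g i *: s`_i.
Proof.
move/(_ (fun y => exists g : 'I_(size s) -> R, y = \sum_i g i *: s`_i)).
apply=> [|y sy].
  split; first by exists (fun=> 0); rewrite big1 // => i _; rewrite scale0r.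
  move=> a _ _ [g ->] [h ->]; exists (fun i => a * g i + h i).
  rewrite scaler_sumr -big_split; apply: eq_bigr => i _ /=.
  by rewrite scalerDl scalerA.
exists (fun i => (i == index y s :> nat)%:R); have si : (index y s < size s)%N by rewrite index_mem.
rewrite (bigD1 (Ordinal si)) //= eqxx scale1r nth_index // big1 ?addr0 // => i.
by rewrite -val_eqE /= => /negPf ->; rewrite scale0r.
Qed.

End Span.

(** * Dickson's lemma *)

Section Dickson.

(** Induction on a bound [v] for some value in the tail: either a smaller bound is available, or the
    present value is minimal. *)
Lemma min_tail (u : nat -> nat) n :
  exists m, (n <= m)%N /\ forall m', (n <= m')%N -> (u m <= u m')%N.
Proof.
have [v Hv] : exists v m, (n <= m)%N /\ (u m <= v)%N by exists (u n), n.
elim: v Hv => [[m [nm]]|v IH [m [nm um]]].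
  by rewrite leqn0 => /eqP um; exists m; split=> // m' _; rewrite um.
case: (excluded_middle_informative (exists m', (n <= m')%N /\ (u m' <= v)%N)) => [/IH //|no].
exists m; split=> // m' nm'; apply: leq_trans um _.
by rewrite ltnNge; apply/negP => um'; apply: no; exists m'.
Qed.

Lemma nondecreasing_subsequence (u : nat -> nat) :
  exists phi : nat -> nat, (forall i, phi i < phi i.+1)%N /\
    forall i, (u (phi i) <= u (phi i.+1))%N.
Proof.
have am n := constructive_indefinite_description _ (min_tail u n).
pose n := fix n i := if i is j.+1 then (sval (am (n j))).+1 else 0%N.
exists (fun i => sval (am (n i))); split=> i.
  by have [] := svalP (am (n i.+1)).
have [le_n min_n] := svalP (am (n i)); apply: min_n.
by have [/ltnW /(leq_trans le_n)] := svalP (am (n i.+1)).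
Qed.

(** One coordinate at a time: a further subsequence keeps the earlier coordinates monotone. *)
Lemma nondecreasing_subsequence_mnm r (x : nat -> 'X_{1..r}) (cs : seq 'I_r) :
  exists phi : nat -> nat, (forall i, phi i < phi i.+1)%N /\
    forall c i, c \in cs -> (x (phi i) c <= x (phi i.+1) c)%N.
Proof.
elim: cs => [|c cs [phi [inc_phi Hphi]]]; first by exists id.
have [psi [inc_psi Hpsi]] := nondecreasing_subsequence (fun i => x (phi i) c).
have lt_phi : {homo phi : i j / (i < j)%N} by apply: homo_ltn => //; apply: ltn_trans.
exists (phi \o psi); split=> [i|d i]; first exact: lt_phi.
rewrite in_cons => /predU1P[->|cd]; first exact: Hpsi.
have le_x : {homo (fun i => x (phi i) d) : i j / (i <= j)%N}.
  by apply: homo_leq => // [|j]; [apply: leq_trans | apply: Hphi].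
by apply: le_x; apply: ltnW.
Qed.

(** Otherwise elements of [P] can be chosen greedily, none divisible by an earlier one, against the
    nondecreasing subsequence. *)
Lemma Dickson r (P : 'X_{1..r} -> Prop) :
  exists s : seq 'X_{1..r}, (forall m, m \in s -> P m) /\
    forall m, P m -> exists2 m', m' \in s & (m' <= m)%MM.
Proof.
apply: NNPP => no.
(* The premise on [s] stands under the existential, so that choice gives a function on all lists. *)
have nxt (s : seq 'X_{1..r}) : exists m, (forall m', m' \in s -> P m') ->
    P m /\ forall m', m' \in s -> ~~ (m' <= m)%MM.
  apply: NNPP => Hs; apply: no; exists s; split=> [m' sm'|m Pm].
    by apply: NNPP => Pm'; apply: Hs; exists 0%MM => /(_ _ sm').
  apply: NNPP => Hm; apply: Hs; exists m => _; split=> // m' sm'.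
  by apply/negP => le_m; apply: Hm; exists m'.
pose f s := sval (constructive_indefinite_description _ (nxt s)).
have fP s := svalP (constructive_indefinite_description _ (nxt s)).
pose S := fix S n := if n is n'.+1 then f (S n') :: S n' else [::].
have PS n m : m \in S n -> P m.
  elim: n m => //= n IH m; rewrite in_cons => /predU1P[->|/IH //].
  by case: (fP (S n) IH).
have S_mem i j : (i < j)%N -> f (S i) \in S j.
  elim: j => // j IH; rewrite ltnS leq_eqVlt /= in_cons => /predU1P[->|/IH ->].
    by rewrite eqxx.
  by rewrite orbT.
have [phi [inc Hphi]] := nondecreasing_subsequence_mnm (fun n => f (S n)) (enum 'I_r).
case: (fP (S (phi 1%N)) (PS _)) => _ /(_ _ (S_mem _ _ (inc 0%N))) /negP; apply.
by apply/mnm_lepP => c; apply: Hphi; rewrite mem_enum.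
Qed.

End Dickson.

(** * Hilbert's basis theorem *)

Section Hilbert.

Variables (k : fieldType) (r : nat).
Local Notation R := {mpoly k[r]}.

Lemma mlead_cancel (p h : R) : p != h -> mlead h = mlead p ->
  h@_(mlead p) = p@_(mlead p) -> (mlead (p - h) < mlead p)%O.
Proof.
move=> ne_ph e_lead e_c; rewrite lt_neqAle; apply/andP; split.
  apply/eqP => e; have := mleadc_eq0 (p - h).
  by rewrite e mcoeffB e_c subrr eqxx subr_eq0 (negPf ne_ph).
by have := mleadB_le p h; rewrite e_lead joinxx.
Qed.

Lemma idealM (P : R^o -> Prop) (f g : R) : submodule P -> P g -> P (f * g).
Proof. by move=> Psub Pg; apply: (@submoduleZ R R^o P f g). Qed.

(** Dickson's lemma yields finitely many elements whose leading monomials divide all those of [I];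
    division by them, as an induction on the leading monomial, ends at 0. *)
Lemma Hilbert_basis (I : R -> Prop) : submodule (I : R^o -> Prop) ->
  exists s : seq R, (forall f, f \in s -> I f) /\
    forall f, I f -> span (s : seq R^o) f.
Proof.
move=> Isub; have [s [sP Hs]] := Dickson (fun m => exists f, [/\ I f, f != 0 & mlead f = m]).
have [fs [fsI Hfs]] : exists fs : seq R, (forall f, f \in fs -> I f) /\
    forall m, m \in s -> exists2 f, f \in fs & f != 0 /\ mlead f = m.
  elim: s sP {Hs} => [|m s IH] sP; first by exists [::].
  have [|fs [fsI Hfs]] := IH; first by move=> m' sm'; apply: sP; rewrite in_cons sm' orbT.
  have [f [If nzf lf]] := sP m (mem_head _ _).
  exists (f :: fs); split=> g; rewrite in_cons => /predU1P[->|] //.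
  - exact: fsI.
  - by exists f; rewrite ?mem_head.
  by move=> /Hfs[h fsh Hh]; exists h => //; rewrite in_cons fsh orbT.
exists fs; split=> // f; elim/mleadrect: f => f IH If.
have [sp0 spD] := span_submodule (fs : seq R^o).
case: (eqVneq f 0) => [-> //|nzf].
have [m' /Hfs[g fsg [nzg lg]] le_m'] : exists2 m', m' \in s & (m' <= mlead f)%MM.
  by apply: Hs; exists f.
(* The multiple of [g] that has the leading term of [f]. *)
pose h := (f@_(mlead f) / g@_(mlead g)) *: ('X_[mlead f - mlead g] * g).
have nzc : f@_(mlead f) / g@_(mlead g) != 0.
  by rewrite mulf_neq0 ?invr_eq0 ?mleadc_eq0.
have nzX : 'X_[mlead f - mlead g] != 0 :> R.
  by rewrite -msupp_eq0 msuppX.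
have lh : mlead h = mlead f.
  by rewrite /h mleadZ // mleadM // mleadXm submK // lg.
have hc : h@_(mlead f) = f@_(mlead f).
  have -> : h@_(mlead f) = f@_(mlead f) / g@_(mlead g) * ('X_[mlead f - mlead g] * g)@_(mlead f).
    by rewrite -mcoeffZ.
  have := mcoeffMX g (mlead f - mlead g)%MM (mlead g); rewrite submK ?lg //.
  by rewrite mulrC => ->; rewrite mulfVK // -lg mleadc_eq0.
have sh : span (fs : seq R^o) h.
  rewrite /h -mul_mpolyC mulrA.
  by apply: (@idealM (span (fs : seq R^o))); [apply: span_submodule | apply: mem_span].
case: (eqVneq f h) => [-> //|ne_fh].
rewrite -[f](subrK h); apply: (@submoduleD R R^o (span (fs : seq R^o))) => //.
apply: IH; first exact: mlead_cancel.
apply: (@submoduleB R R^o I) => //; rewrite /h -mul_mpolyC mulrA.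
by apply: (@idealM I) => //; apply: fsI.
Qed.

(** Induction on a list of coordinates that separates [P] from 0. The kernel of the coordinate [j]
    falls to the induction hypothesis, its image is an ideal, and generators of that ideal are
    lifted to [P]. *)
Lemma submodule_fin_generated l (P : 'rV[R]_l -> Prop) : submodule P ->
  exists s : seq 'rV[R]_l, (forall v, v \in s -> P v) /\ forall v, P v -> span s v.
Proof.
move=> Psub; have : forall v, P v -> (forall j, j \in enum 'I_l -> v 0 j = 0) -> v = 0.
  by move=> v _ v0; apply/rowP => j; rewrite mxE v0 ?mem_enum.
elim: (enum _) P Psub => [|j cs IH] P Psub sep.
  exists [::]; split=> // v Pv; rewrite (sep v Pv) //.
  by case: (span_submodule ([::] : seq 'rV[R]_l)).
have [P0 PD] := Psub.
have [||s0 [s0P Hs0]] := IH (fun v => P v /\ v 0 j = 0).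
- split=> [|a x y [Px xj] [Py yj]]; first by rewrite mxE.
  by rewrite !mxE xj yj mulr0 addr0; split=> //; apply: PD.
- move=> v [Pv vj] v0; apply: sep => // c; rewrite in_cons => /predU1P[->//|]; exact: v0.
have [|t [tI Ht]] := @Hilbert_basis (fun f => exists2 v, P v & v 0 j = f).
  split=> [|a _ _ [x Px <-] [y Py <-]]; first by exists 0; rewrite ?mxE.
  by exists (a *: x + y); [apply: PD | rewrite !mxE].
have [vs [vsP Hvs]] : exists vs : seq 'rV[R]_l, (forall v, v \in vs -> P v) /\
    forall f, f \in t -> exists2 v, v \in vs & v 0 j = f.
  elim: t tI {Ht} => [|f t IHt] tI; first by exists [::].
  have [|vs [vsP Hvs]] := IHt; first by move=> g tg; apply: tI; rewrite in_cons tg orbT.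
  have [v Pv vf] := tI f (mem_head _ _).
  exists (v :: vs); split=> w; rewrite in_cons => /predU1P[->|] //.
  - exact: vsP.
  - by exists v; rewrite ?mem_head.
  by move=> /Hvs[u su Hu]; exists u => //; rewrite in_cons su orbT.
exists (vs ++ s0); split=> [v|v Pv].
  by rewrite mem_cat => /orP[/vsP //|/s0P []].
have spS := span_submodule (vs ++ s0).
(* The lift of [v 0 j] must lie in [P] too, so that its difference from [v] belongs to the kernel
   generated by [s0]. *)
have : span (t : seq R^o) (v 0 j) by apply: Ht; exists v.
case/(_ (fun f => exists w, [/\ span (vs ++ s0) w, P w & w 0 j = f])).
- split=> [|a _ _ [x [sx Px <-]] [y [sy Py <-]]].
    by exists 0; rewrite mxE; split=> //; case: spS.
  exists (a *: x + y); rewrite !mxE; split=> //; last exact: PD.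
  by case: spS => _; apply.
- move=> f /Hvs[w vsw wf]; exists w; split=> //; last exact: vsP.
  by apply: mem_span; rewrite mem_cat vsw.
move=> w [sw Pw wj]; rewrite -[v](subrK w); apply: (submoduleD spS) => //.
have : span s0 (v - w).
  by apply: Hs0; rewrite !mxE wj subrr; split=> //; apply: submoduleB.
by move/(_ _ spS); apply=> u s0u; apply: mem_span; rewrite mem_cat s0u orbT.
Qed.

End Hilbert.

(** * The Magnus embedding *)

Section MagnusAlgebra.

Variables (k : fieldType) (r : nat).
Local Notation R := {mpoly k[r]}.

Definition linX (v : 'rV[k]_r) : R := \sum_i (v 0 i)%:MP * 'X_i.

Lemma linXP c u v : linX (c *: u + v) = c%:MP * linX u + linX v.
Proof.
rewrite /linX mulr_sumr -big_split; apply: eq_bigr => i _ /=.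
by rewrite !mxE mpolyCD mpolyCM; ring.
Qed.

Lemma linX0 : linX 0 = 0.
Proof. by rewrite /linX big1 // => i _; rewrite mxE mul0r. Qed.

Lemma linX_delta i : linX (delta_mx 0 i) = 'X_i.
Proof.
rewrite /linX (bigD1 i) //= mxE !eqxx mul1r big1 ?addr0 // => j /negPf nij.
by rewrite mxE nij andbF mul0r.
Qed.

Lemma linX_eq0 v : linX v = 0 -> v = 0.
Proof.
move=> v0; apply/rowP => i; rewrite mxE.
have := congr1 (mcoeff U_(i)%MM) v0; rewrite mcoeff0 raddf_sum (bigD1 i) //=.
rewrite mcoeffCM mcoeffXU eqxx mulr1 big1 ?addr0 // => j /negPf nij.
by rewrite mcoeffCM mcoeffXU nij mulr0.
Qed.

(* The split extension of the abelian algebra k^r by the free module R^r: the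
   target of the Magnus embedding. *)
Definition magnus : Type := ('rV[k]_r * {ffun 'I_r -> R})%type.
HB.instance Definition _ := GRing.Lmodule.on magnus.

Definition magnus_br (p q : magnus) : magnus :=
  (0, [ffun i => p.2 i * linX q.1 - q.2 i * linX p.1]).

Lemma magnus_br2 p q i : (magnus_br p q).2 i = p.2 i * linX q.1 - q.2 i * linX p.1.
Proof. by rewrite ffunE. Qed.

Lemma magnus_ext (p q : magnus) : p.1 = q.1 -> p.2 =1 q.2 -> p = q.
Proof. by case: p q => [p1 p2] [q1 q2] /= -> /ffunP ->. Qed.

Lemma magnus20 i : (0 : magnus).2 i = 0.
Proof. by rewrite ffunE. Qed.

Lemma magnus2D (p q : magnus) i : (p + q).2 i = p.2 i + q.2 i.
Proof. by rewrite ffunE. Qed.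

Lemma magnus2Z c (p : magnus) i : (c *: p).2 i = c%:MP * p.2 i.
Proof. by rewrite ffunE mul_mpolyC. Qed.

Lemma magnus_lie : is_lie magnus_br.
Proof.
split=> [c x y z|c x y z|x|x y z]; apply: magnus_ext => [|i].
- by rewrite /= scaler0 addr0.
- rewrite magnus2D magnus2Z !magnus_br2 !magnus2D !magnus2Z linXP; ring.
- by rewrite /= scaler0 addr0.
- rewrite magnus2D magnus2Z !magnus_br2 !magnus2D !magnus2Z linXP; ring.
- by [].
- by rewrite ffunE subrr ffunE.
- by rewrite /= !addr0.
rewrite !magnus2D !magnus_br2 !ffunE /= linX0; ring.
Qed.

Lemma magnus_metabelian : metabelian magnus_br.
Proof.
move=> x1 x2 x3 x4; apply: magnus_ext => [|i] //=.
by rewrite !ffunE /= linX0 !mulr0 subr0.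
Qed.

Lemma magnus_square u : in_square magnus_br u -> u.1 = 0.
Proof.
by case=> s ->; elim/big_ind: _ => // x y /= -> ->; rewrite addr0.
Qed.

(** A bracket has zero linear part, so bracketing it with [x] multiplies it by [linX x.1]. In a
    domain it is therefore 0, unless both linear forms are 0, and then it is 0 again. *)
Lemma magnus_Phi2 x y :
  magnus_br (magnus_br x y) x = 0 -> magnus_br (magnus_br x y) y = 0 ->
  magnus_br x y = 0.
Proof.
have [n En] : exists n, n = magnus_br x y by eexists.
rewrite -En => nx ny; apply: magnus_ext => [|i]; first by rewrite En.
have n1 : n.1 = 0 by rewrite En.
have : (magnus_br n x).2 i = 0 by rewrite nx magnus20.
have : (magnus_br n y).2 i = 0 by rewrite ny magnus20.
rewrite !magnus_br2 n1 linX0 !mulr0 !subr0 magnus20 => /eqP ey /eqP ex.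
move: ex; rewrite mulf_eq0 => /orP[/eqP -> //|/eqP/linX_eq0 x0].
move: ey; rewrite mulf_eq0 => /orP[/eqP -> //|/eqP/linX_eq0 y0].
by rewrite En magnus_br2 x0 y0 linX0 !mulr0 subrr.
Qed.

(** Commuting with [x] is a proportionality. A nonzero [linX x.1] can be cancelled; otherwise a
    nonzero coordinate of [x.2] kills the linear parts of [y] and [z]. *)
Lemma magnus_Phi3 x y z : x <> 0 -> magnus_br x y = 0 -> magnus_br x z = 0 ->
  magnus_br y z = 0.
Proof.
move=> nzx xy xz; apply: magnus_ext => // i.
have ey j : x.2 j * linX y.1 = y.2 j * linX x.1.
  by apply/eqP; rewrite -subr_eq0 -magnus_br2 xy magnus20.
have ez j : x.2 j * linX z.1 = z.2 j * linX x.1.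
  by apply/eqP; rewrite -subr_eq0 -magnus_br2 xz magnus20.
rewrite magnus_br2 magnus20.
case: (eqVneq (linX x.1) 0) => [x1|nz]; last first.
  apply: (mulIf nz); rewrite mul0r.
  transitivity (y.2 i * linX x.1 * linX z.1 - z.2 i * linX x.1 * linX y.1); first by ring.
  by rewrite -ey -ez; ring.
case: (excluded_middle_informative (exists j, x.2 j != 0)) => [[j nzj]|no].
  move/eqP: (ey j); rewrite x1 mulr0 mulf_eq0 (negPf nzj) /= => /eqP ->.
  move/eqP: (ez j); rewrite x1 mulr0 mulf_eq0 (negPf nzj) /= => /eqP ->.
  by rewrite !mulr0 subrr.
case: nzx; apply: magnus_ext => [|j]; first exact: linX_eq0.
by rewrite magnus20; apply/eqP/negPn/negP => nzj; apply: no; exists j.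
Qed.

End MagnusAlgebra.

(** * Injectivity of the Magnus map *)

Section MagnusEmbedding.

Variables (k : fieldType) (r : nat) (F : lmodType k) (br : F -> F -> F).
Variable a : 'I_r -> F.
Hypothesis HF : is_free_metabelian br a.
Local Notation R := {mpoly k[r]}.
Local Notation pact y f := (poly_act br y f a).
Local Notation mact y m := (mono_act br y m a).

Variable mu : F -> magnus k r.
Hypothesis muP : is_lie_hom br (@magnus_br k r) mu.
Hypothesis mu_gen : forall i, mu (a i) = (delta_mx 0 i, [ffun j => (j == i)%:R]).

Let brP : is_lie br. Proof. by case: HF. Qed.
Let met : metabelian br. Proof. by case: HF. Qed.
Let sqP : act_closed br a (in_square br) := metabelian_act_closed a brP met.

Lemma muD x y : mu (x + y) = mu x + mu y. Proof. by case: muP. Qed.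
Lemma muZ c x : mu (c *: x) = c *: mu x. Proof. by case: muP. Qed.
Lemma mu_br x y : mu (br x y) = magnus_br (mu x) (mu y). Proof. by case: muP. Qed.
Lemma mu0 : mu 0 = 0. Proof. exact: (lie_hom0 muP). Qed.

Lemma mu_gen1 i : (mu (a i)).1 = delta_mx 0 i. Proof. by rewrite mu_gen. Qed.
Lemma mu_gen2 i j : (mu (a i)).2 j = (j == i)%:R. Proof. by rewrite mu_gen ffunE. Qed.

Lemma mu1_lin (alpha : 'I_r -> k) : (mu (\sum_i alpha i *: a i)).1 = \row_i alpha i.
Proof.
rewrite (lie_hom_sum muP); apply/rowP => j; rewrite mxE.
rewrite (raddf_sum (fst : magnus k r -> _)) summxE (bigD1 j) //= muZ mu_gen !mxE !eqxx mulr1 big1 ?addr0 //.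
by move=> i /negPf nij; rewrite muZ mu_gen !mxE eq_sym nij mulr0.
Qed.

Lemma mu1_square u : in_square br u -> (mu u).1 = 0.
Proof. by move/(lie_hom_square muP)/magnus_square. Qed.

Lemma mu2_poly_act y f i : in_square br y -> (mu (pact y f)).2 i = f * (mu y).2 i.
Proof.
move=> Vy; elim/lext_ind: f => [|f g Hf Hg|c f Hf|m].
- by rewrite poly_act0r mu0 mul0r magnus20.
- by rewrite poly_actDr muD magnus2D Hf Hg mulrDl.
- by rewrite poly_actZr muZ magnus2Z Hf mulrA mul_mpolyC.
rewrite poly_actX; elim/mnm_rect_U: m => [|m j IH].
  by rewrite mono_act_m0 mpolyX0 mul1r.
rewrite (mono_act_mulU sqP) // mu_br magnus_br2 IH mu_gen1 linX_delta.
rewrite (mu1_square (mono_act_closed sqP m Vy)) linX0 mulr0 subr0 mpolyXD; ring.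
Qed.

Definition square_span (u : F) : Prop := exists f : 'I_r -> 'I_r -> R,
  u = \sum_i \sum_j pact (br (a i) (a j)) (f i j).

Lemma square_span0 : square_span 0.
Proof.
by exists (fun _ _ => 0); rewrite big1 // => i _; rewrite big1 // => j _; rewrite poly_act0r.
Qed.

Lemma square_spanD u v : square_span u -> square_span v -> square_span (u + v).
Proof.
move=> [f ->] [g ->]; exists (fun i j => f i j + g i j).
rewrite -big_split; apply: eq_bigr => i _ /=; rewrite -big_split.
by apply: eq_bigr => j _ /=; rewrite poly_actDr.
Qed.

Lemma square_spanZ c u : square_span u -> square_span (c *: u).
Proof.
move=> [f ->]; exists (fun i j => c *: f i j); rewrite scaler_sumr.
apply: eq_bigr => i _ /=; rewrite scaler_sumr.
by apply: eq_bigr => j _ /=; rewrite poly_actZr.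
Qed.

Lemma square_span_br u i : square_span u -> square_span (br u (a i)).
Proof.
move=> [f ->]; exists (fun l j => f l j * 'X_i); rewrite br_suml //.
apply: eq_bigr => l _ /=; rewrite br_suml //; apply: eq_bigr => j _ /=.
by rewrite (poly_act_br brP sqP) //; apply: in_square_br.
Qed.

Lemma square_span_gen i j : square_span (br (a i) (a j)).
Proof.
exists (fun i' j' => ((i' == i) && (j' == j))%:R).
rewrite (bigD1 i) //= (bigD1 j) //= !eqxx poly_act1 big1 ?addr0 => [|j' /negPf ->].
  rewrite big1 ?addr0 // => i' /negPf ->; rewrite big1 // => j' _.
  by rewrite poly_act0r.
by rewrite poly_act0r.
Qed.

Lemma square_span_square u : square_span u -> in_square br u.
Proof.
move=> [f ->]; apply: in_square_sum => i _; apply: in_square_sum => j _.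
exact/(poly_act_closed sqP)/in_square_br.
Qed.

Lemma free_decomp u : exists (alpha : 'I_r -> k) s,
  square_span s /\ u = \sum_i alpha i *: a i + s.
Proof.
case: HF => _ _ gen _; apply: (generated_decomp brP _ _ _ _ _ _ gen).
- exact: square_span0.
- exact: square_spanD.
- exact: square_spanZ.
- exact: square_span_br.
- by move=> x y Sx Sy; apply: (metabelian_square brP met); apply: square_span_square.
- exact: square_span_gen.
move=> _ [i ->]; exists (fun j => (j == i)%:R), 0; split; first exact: square_span0.
by rewrite sum_delta addr0.
Qed.

Lemma square_spanP u : (mu u).1 = 0 -> square_span u.
Proof.
have [al [s [Ss ->]]] := free_decomp u.
rewrite muD /= mu1_lin (mu1_square (square_span_square Ss)) addr0 => al0.
suff -> : \sum_i al i *: a i = 0 by rewrite add0r.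
rewrite big1 // => i _; have := congr1 (fun v : 'rV[k]_r => v 0 i) al0.
by rewrite !mxE => ->; rewrite scale0r.
Qed.

Lemma squareP u : in_square br u <-> (mu u).1 = 0.
Proof. by split=> [/mu1_square|/square_spanP/square_span_square]. Qed.

(* A left inverse of the Magnus map on F^2: the basis vector e_i x^m goes to
   [a_i, a_j] . (x^m / x_j), where x_j is the first variable of x^m, if j < i,
   and to 0 otherwise. *)
Definition contract1 (i : 'I_r) (m : 'X_{1..r}) : F :=
  if [pick j : 'I_r | (m j != 0%N) && [forall l : 'I_r, (l < j)%N ==> (m l == 0%N)]] is Some j
  then if (j < i)%N then mact (br (a i) (a j)) (m - U_(j))%MM else 0
  else 0.

Definition contract (v : 'I_r -> R) : F := \sum_i lext (contract1 i) (v i).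

Lemma contract1E i (m : 'X_{1..r}) (j : 'I_r) :
  m j != 0%N -> (forall l : 'I_r, (l < j)%N -> m l = 0%N) ->
  contract1 i m = if (j < i)%N then mact (br (a i) (a j)) (m - U_(j))%MM else 0.
Proof.
move=> mj minj; rewrite /contract1; case: pickP => [l /andP[ml /forallP minl]|/(_ j)]; last first.
  rewrite mj /= => /negP[]; apply/forallP => l; apply/implyP => lj.
  by rewrite minj.
suff -> : l = j by [].
apply: val_inj; apply/eqP; rewrite eqn_leq leqNgt [X in _ && X]leqNgt; apply/andP; split; apply/negP => lt.
  by have := minl j; rewrite lt (negPf mj).
by rewrite minj ?eqxx in ml.
Qed.

Lemma contract1_eq0 (i : 'I_r) (m : 'X_{1..r}) :
  (forall l : 'I_r, (l < i)%N -> m l = 0%N) -> contract1 i m = 0.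
Proof.
move=> minj; rewrite /contract1; case: pickP => // j /andP[mj _].
by case: ltnP => // /minj mj0; rewrite mj0 in mj.
Qed.

(** The Magnus vector of [a_i, a_j] . x^m is e_i x_j x^m - e_j x_i x^m. Let j < i. If no variable of
    m precedes x_j, the second term contracts to 0 and the first to the right-hand side. Otherwise
    both contract along the first variable x_q of m, and Jacobi for a_i, a_j, a_q gives the
    equality. *)
Lemma contract_mono i j m :
  contract1 i (m + U_(j))%MM - contract1 j (m + U_(i))%MM = mact (br (a i) (a j)) m.
Proof.
(* Both sides are antisymmetric in i and j. *)
wlog lt_ji : i j / (j < i)%N => [H|].
  have [e|ne] := eqVneq i j.
    by rewrite e subrr brxx // mono_act0.
  have [lt|lt|e] := ltngtP j i; first exact: H.
    by rewrite -opprB H // (brC brP (a i)) mono_actN.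
  by rewrite (val_inj e) eqxx in ne.
case: (pickP [pred q : 'I_r | (m q != 0%N) && (q < j)%N]) => [q0 Hq0|none]; last first.
  have m0 (l : 'I_r) : (l < j)%N -> m l = 0%N.
    by move=> lj; have /= := none l; rewrite lj andbT => /negbFE/eqP.
  rewrite (@contract1E _ _ j) => [||l lj]; first last.
  - by rewrite mnmDE mnm1E m0 //; case: eqVneq lj => // ->; rewrite ltnn.
  - by rewrite mnmDE mnm1E eqxx addn1.
  rewrite lt_ji addmK contract1_eq0 ?subr0 // => l lj.
  rewrite mnmDE mnm1E m0 //; case: eqVneq => // e.
  by move: (ltn_trans lj lt_ji); rewrite e ltnn.
have [q /andP[/= mq qj] minq] := arg_minnP (fun q : 'I_r => q : nat) Hq0.
have m0 (l : 'I_r) : (l < q)%N -> m l = 0%N.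
  move=> lq; apply/eqP/negPn/negP => ml.
  by have := minq l; rewrite /= ml (ltn_trans lq qj) leqNgt lq => /(_ isT).
have qi := ltn_trans qj lt_ji.
have minq' (c l : 'I_r) : (q < c)%N -> (l < q)%N -> (m + U_(c))%MM l = 0%N.
  move=> qc lq; rewrite mnmDE mnm1E m0 //; case: eqVneq => // e.
  by move: (ltn_trans lq qc); rewrite e ltnn.
have mcq (c : 'I_r) : (m + U_(c))%MM q != 0%N by rewrite mnmDE addn_eq0 (negPf mq).
rewrite (contract1E _ (mcq j) (fun l => @minq' j l qj)) (contract1E _ (mcq i) (fun l => @minq' i l qi)).
rewrite qi qj; have le_q : (U_(q) <= m)%MM by rewrite lep1mP.
have e c : (m + U_(c) - U_(q) = (m - U_(q)) + U_(c))%MM.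
  by rewrite -{1}(submK le_q) -addmA (addmC U_(q)%MM) addmA addmK.
rewrite !e -[in RHS](submK le_q).
have sq x y := in_square_br br x y.
rewrite !(mono_act_mulU sqP) // -!(mono_act_br sqP) // -mono_actN // -mono_actD //.
congr (mono_act br _ _ a); apply/eqP; rewrite subr_eq; apply/eqP.
by rewrite br_swap // (brC brP (a i) (br _ _)) (brC brP (a q)) brNl // opprK.
Qed.

Lemma contract_mu2 u : in_square br u -> contract (fun i => (mu u).2 i) = u.
Proof.
have cD v w : contract (fun i => v i + w i) = contract v + contract w.
  by rewrite -big_split; apply: eq_bigr => i _; rewrite lextD.
have c0 v : v =1 (fun=> 0) -> contract v = 0.
  by move=> v0; apply: big1 => i _; rewrite v0 lext0.
have cE v w : v =1 w -> contract v = contract w.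
  by move=> e; apply: eq_bigr => i _; rewrite e.
have cmu x y : contract (fun i => (mu (x + y)).2 i) =
    contract (fun i => (mu x).2 i) + contract (fun i => (mu y).2 i).
  by rewrite -cD; apply: cE => i; rewrite muD magnus2D.
move=> Vu; have [f ->] : square_span u by apply/square_spanP/squareP.
apply: (big_ind (fun u => contract (fun i => (mu u).2 i) = u)) => [|x y ex ey|i _].
- by apply: c0 => i; rewrite mu0 magnus20.
- by rewrite cmu ex ey.
apply: (big_ind (fun u => contract (fun i => (mu u).2 i) = u)) => [|x y ex ey|j _].
- by apply: c0 => j; rewrite mu0 magnus20.
- by rewrite cmu ex ey.
(* [d l i g] is the coordinate [l] of the vector with the single entry [g] at [i]; the Magnus vector
   of [a_i, a_j] . f has f x_j at i and - f x_i at j. *)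
pose d (l i : 'I_r) (g : R) := (l == i)%:R * g.
rewrite (cE _ (fun l => d l i (f i j * 'X_j) + d l j (- (f i j * 'X_i)))); last first.
  move=> l; rewrite mu2_poly_act; last exact: in_square_br.
  by rewrite mu_br magnus_br2 !mu_gen2 !mu_gen1 !linX_delta /d; ring.
have cd l g : contract (fun i => d i l g) = lext (contract1 l) g.
  rewrite /contract (bigD1 l) //= /d eqxx mul1r big1 ?addr0 // => l' /negPf ->.
  by rewrite mul0r lext0.
rewrite cD !cd; elim/lext_ind: {f}(f i j) => [|g h Hg Hh|c g Hg|m].
- by rewrite !mul0r oppr0 !lext0 addr0 poly_act0r.
- by rewrite !mulrDl opprD !lextD poly_actDr -Hg -Hh addrACA.
- by rewrite -!scalerAl -scalerN !lextZ poly_actZr -Hg scalerDr.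
rewrite -!mpolyXD poly_actX -contract_mono lextX; congr (_ + _).
by have := lextZ (contract1 j) (-1) 'X_[m + U_(i)]; rewrite !scaleN1r lextX.
Qed.

Lemma mu_inj : injective mu.
Proof.
move=> u v e; apply/eqP; rewrite -subr_eq0; apply/eqP.
have e0 : mu (u - v) = 0 by rewrite (lie_homB muP) e subrr.
have Vuv : in_square br (u - v) by apply/squareP; rewrite e0.
rewrite -(contract_mu2 Vuv).
by rewrite e0; apply: big1 => i _; rewrite magnus20 lext0.
Qed.

End MagnusEmbedding.

(** * The axioms in the free metabelian algebra *)

Section FreeAxioms.

Variables (k : fieldType) (r : nat) (F : lmodType k) (br : F -> F -> F).
Variable a : 'I_r -> F.
Hypothesis HF : is_free_metabelian br a.
Hypothesis Hr : (2 <= r)%N.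
Local Notation R := {mpoly k[r]}.
Local Notation pact y f := (poly_act br y f a).

Variable mu : F -> magnus k r.
Hypothesis muP : is_lie_hom br (@magnus_br k r) mu.
Hypothesis mu_gen : forall i, mu (a i) = (delta_mx 0 i, [ffun j => (j == i)%:R]).

Let brP : is_lie br. Proof. by case: HF. Qed.
Let met : metabelian br. Proof. by case: HF. Qed.
Let muI : injective mu := mu_inj HF muP mu_gen.
Let sqP u : in_square br u <-> (mu u).1 = 0 := squareP HF muP mu_gen u.
Let mbr := mu_br muP.
Let mu00 := mu0 muP.

Lemma mu_eq0 u : mu u = 0 -> u = 0.
Proof. by move=> e; apply: muI; rewrite mu00. Qed.

Lemma exists_square_neq0 : exists w i, in_square br w /\ (mu w).2 i != 0.
Proof.
have r0 : (0 < r)%N by apply: leq_trans Hr.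
(* The coordinate 0 of the Magnus vector of [a_0, a_1] is x_1. *)
exists (br (a (Ordinal r0)) (a (Ordinal Hr))), (Ordinal r0); split; first exact: in_square_br.
rewrite mbr magnus_br2 !(mu_gen1 mu_gen) !(mu_gen2 mu_gen).
have ne : (Ordinal r0 == Ordinal Hr) = false by [].
by rewrite !linX_delta eqxx ne mul1r mul0r subr0 -msize_poly_eq0 msizeX mdeg1.
Qed.

(** For a nonzero [w] in F^2, the product of u, w, u is, up to sign, w times the square of the
    linear form of u; the Fit condition makes that form 0. *)
Lemma FitEl_square u : FitEl br u <-> in_square br u.
Proof.
split=> [Fu|Vu y]; last by apply: (metabelian_square brP met) => //; apply: in_square_br.
apply/sqP; have [w [i [/sqP w1 nz]]] := exists_square_neq0.
have : (mu (br (br u w) u)).2 i = 0 by rewrite Fu mu00 magnus20.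
rewrite !(mbr, magnus_br2) w1 linX0 !(mulr0, sub0r, subr0) mulNr => /eqP.
by rewrite oppr_eq0 !mulf_eq0 (negPf nz) orbb => /eqP/linX_eq0.
Qed.

Lemma free_Phi2 : Phi2 br.
Proof.
move=> x y xyx xyy; apply: mu_eq0; rewrite mbr.
by apply: magnus_Phi2; rewrite -!mbr ?xyx ?xyy mu00.
Qed.

Lemma free_Phi3 : Phi3 br.
Proof.
move=> x y z nzx xy xz; apply: mu_eq0; rewrite mbr.
apply: (@magnus_Phi3 _ _ (mu x)); first by move=> /mu_eq0.
  by rewrite -mbr xy mu00.
by rewrite -mbr xz mu00.
Qed.

Definition mu1_mx n (x : 'I_n -> F) : 'M[k]_(n, r) := \matrix_(i, j) (mu (x i)).1 0 j.

Lemma mu1_comb n (x : 'I_n -> F) (alpha : 'rV[k]_n) :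
  (mu (\sum_i alpha 0 i *: x i)).1 = alpha *m mu1_mx x.
Proof.
rewrite (lie_hom_sum muP); apply/rowP => j; rewrite (raddf_sum (fst : magnus k r -> _)).
by rewrite summxE mxE; apply: eq_bigr => i _; rewrite (muZ muP) !mxE.
Qed.

Lemma varphi_row_free n (x : 'I_n -> F) : varphi br x <-> row_free (mu1_mx x).
Proof.
split=> [Hx|/row_free_inj inj alpha [i nzi] /FitEl_square/sqP].
  rewrite -kermx_eq0; apply/rowV0P => v /sub_kermxP v0.
  apply/rowP => i; rewrite mxE; apply/eqP/negPn/negP => nzi.
  apply: (Hx (fun i => v 0 i)); first by exists i.
  by apply/FitEl_square/sqP; rewrite mu1_comb.
have -> : \sum_i alpha i *: x i = \sum_i (\row_i alpha i) 0 i *: x i.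
  by apply: eq_bigr => j _; rewrite mxE.
rewrite mu1_comb -(mul0mx 1 (mu1_mx x)) => /inj.
by move/rowP/(_ i); rewrite !mxE => e; rewrite e eqxx in nzi.
Qed.

Lemma free_Phi4 : Phi4 r br.
Proof.
move=> x /varphi_row_free; rewrite /row_free => /eqP e.
by have := rank_leq_col (mu1_mx x); rewrite e ltnn.
Qed.

Lemma free_torsion_free y (f : R) : in_square br y -> f != 0 -> pact y f = 0 -> y = 0.
Proof.
move=> Vy nzf e; apply: mu_eq0; apply: magnus_ext => [|i]; first exact/sqP.
have := mu2_poly_act HF muP mu_gen f i Vy.
by rewrite e mu00 magnus20 => /esym/eqP; rewrite mulf_eq0 (negPf nzf) => /eqP.
Qed.

Lemma free_hom_ext (B : lmodType k) (brB : B -> B -> B) (h1 h2 : F -> B) :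
  is_lie_hom br brB h1 -> is_lie_hom br brB h2 -> (forall i, h1 (a i) = h2 (a i)) ->
  h1 =1 h2.
Proof.
move=> H1 H2 e; case: HF => _ _ gen _; apply: (gen (fun u => h1 u = h2 u)).
- by rewrite (lie_hom0 H1) (lie_hom0 H2).
- by case: H1 H2 => D1 _ _ [D2 _ _] x y ex ey; rewrite D1 D2 ex ey.
- by case: H1 H2 => _ Z1 _ [_ Z2 _] c x ex; rewrite Z1 Z2 ex.
- by case: H1 H2 => _ _ b1 [_ _ b2] x y ex ey; rewrite b1 b2 ex ey.
by move=> _ [i ->].
Qed.

(** Brackets have entries in the augmentation ideal, so constant terms only see the linear part.
    This gives the matrix of [unipotent_hom_inj] at the origin. *)
Lemma mu2_meval0 u i : ((mu u).2 i).@[fun=> 0] = (mu u).1 0 i.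
Proof.
have l0 v : (linX v : R).@[fun=> 0] = 0.
  by rewrite raddf_sum big1 // => j _ /=; rewrite mevalM mevalXU mulr0.
case: HF => _ _ gen _.
apply: (gen (fun u => ((mu u).2 i).@[fun=> 0] = (mu u).1 0 i)).
- by rewrite mu00 magnus20 meval0 mxE.
- by move=> x y ex ey; rewrite (muD muP) magnus2D mevalD ex ey mxE.
- by move=> c x ex; rewrite (muZ muP) magnus2Z mevalM mevalC ex mxE.
- by move=> x y _ _; rewrite mbr magnus_br2 mevalB !mevalM !l0 !mulr0 subrr mxE.
move=> _ [j ->]; rewrite (mu_gen2 mu_gen) (mu_gen1 mu_gen) mxE eqxx /=.
by case: (i == j); rewrite ?meval1 ?meval0.
Qed.

(* Such an endomorphism acts on the R^r-component of the Magnus algebra by a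
   matrix that is the identity modulo the augmentation ideal. *)
Lemma unipotent_hom_inj (T : F -> F) :
  is_lie_hom br br T -> (forall i, (mu (T (a i))).1 = delta_mx 0 i) -> injective T.
Proof.
move=> TP T1; pose C : 'M[R]_r := \matrix_(j, i) (mu (T (a j))).2 i.
have mu1T u : (mu (T u)).1 = (mu u).1.
  case: HF => _ _ gen _; apply: (gen (fun u => (mu (T u)).1 = (mu u).1)).
  - by rewrite (lie_hom0 TP).
  - by case: TP => TD _ _ x y ex ey; rewrite TD !(muD muP) /= ex ey.
  - by case: TP => _ TZ _ c x ex; rewrite TZ !(muZ muP) /= ex.
  - by case: TP => _ _ Tb x y _ _; rewrite Tb !mbr.
  by move=> _ [i ->]; rewrite T1 (mu_gen1 mu_gen).
(* A chain rule: Magnus coordinates are Fox derivatives and [C] is the Jacobian of [T]. The entries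
   of [mu u] need no substitution, as [T] preserves linear parts. *)
have mu2T u i : (mu (T u)).2 i = \sum_j (mu u).2 j * C j i.
  case: HF => _ _ gen _.
  apply: (gen (fun u => (mu (T u)).2 i = \sum_j (mu u).2 j * C j i)).
  - rewrite (lie_hom0 TP) mu00 magnus20 big1 // => j _.
    by rewrite magnus20 mul0r.
  - case: TP => TD _ _ x y ex ey; rewrite TD !(muD muP) magnus2D ex ey -big_split.
    by apply: eq_bigr => j _; rewrite magnus2D mulrDl.
  - case: TP => _ TZ _ c x ex; rewrite TZ (muZ muP) magnus2Z ex mulr_sumr.
    by apply: eq_bigr => j _; rewrite (muZ muP) magnus2Z mulrA.
  - case: TP => _ _ Tb x y ex ey; rewrite Tb !mbr magnus_br2 ex ey !mu1T !mulr_suml -sumrB.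
    by apply: eq_bigr => j _; rewrite magnus_br2; ring.
  move=> _ [l ->]; rewrite (bigD1 l) //= (mu_gen2 mu_gen) eqxx mul1r mxE big1 ?addr0 //.
  by move=> j /negPf nj; rewrite (mu_gen2 mu_gen) nj mul0r.
(* At the origin [C] is the identity, so its determinant is a nonzero polynomial and multiplying by
   the adjugate cancels [C]. *)
have detC : \det C != 0.
  apply/eqP => C0; have := det_map_mx (meval (fun=> 0 : k)) C.
  have -> : map_mx (meval (fun=> 0)) C = 1%:M.
    by apply/matrixP => j i; rewrite !mxE mu2_meval0 T1 mxE eqxx /= eq_sym.
  by rewrite det1 C0 rmorph0 => /eqP; rewrite oner_eq0.
move=> u v e; apply/eqP; rewrite -subr_eq0; apply/eqP/mu_eq0.
have : T (u - v) = 0 by rewrite (lie_homB TP) e subrr.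
move: (u - v) => w Tw; apply: magnus_ext => [|i]; first by rewrite -mu1T Tw mu00.
pose m := \row_i (mu w).2 i; have mC : m *m C = 0.
  apply/rowP => j; rewrite !mxE -[RHS](magnus20 k (r := r) j) -mu00 -Tw mu2T.
  by apply: eq_bigr => l _; rewrite !mxE.
have := congr1 (mulmx^~ (\adj C)) mC; rewrite -mulmxA mul_mx_adj mul0mx.
rewrite mul_mx_scalar => /rowP/(_ i); rewrite !mxE => /eqP.
by rewrite mulf_eq0 (negPf detC) => /eqP ->; rewrite magnus20.
Qed.

(** The inverse linear substitution [psi'] normalises the linear part of [h], which makes
    [h \o psi'] unipotent. *)
Lemma free_hom_inj (h : F -> F) : is_lie_hom br br h ->
  mu1_mx (fun i => h (a i)) \in unitmx -> injective h.
Proof.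
move=> hP; set X := mu1_mx _ => uX.
case: (HF) => _ _ _ univ.
have [psi [psiP psiE]] := univ F br brP met (fun j => \sum_i X j i *: a i).
have [psi' [psi'P psi'E]] := univ F br brP met (fun j => \sum_i (invmx X) j i *: a i).
have comp (f g : F -> F) : is_lie_hom br br f -> is_lie_hom br br g -> is_lie_hom br br (f \o g).
  move=> [fD fZ fb] [gD gZ gb]; split=> [x y|c x|x y] /=.
  - by rewrite gD fD.
  - by rewrite gZ fZ.
  by rewrite gb fb.
have linE f (b : 'I_r -> F) (Y : 'M[k]_r) j : is_lie_hom br br f -> (forall i, f (a i) = b i) ->
    f (\sum_i Y j i *: a i) = \sum_i Y j i *: b i.
  move=> fP fE; rewrite (lie_hom_sum fP); apply: eq_bigr => i _.
  by case: fP => _ fZ _; rewrite fZ fE.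
have psiK : cancel psi psi'.
  apply: (free_hom_ext (comp _ _ psi'P psiP) (h2 := id)) => // j /=.
  rewrite psiE (linE _ _ _ _ psi'P psi'E).
  rewrite (eq_bigr (fun i => \sum_l (X j i * invmx X i l) *: a l)); last first.
    by move=> i _; rewrite scaler_sumr; apply: eq_bigr => l _; rewrite scalerA.
  rewrite exchange_big /= -[RHS](@sum_delta k F _ j a); apply: eq_bigr => l _.
  rewrite -scaler_suml; congr (_ *: _).
  by have /matrixP/(_ j l) := mulmxV uX; rewrite !mxE eq_sym.
have hE : h =1 (h \o psi') \o psi by move=> x /=; rewrite psiK.
have TI : injective (h \o psi').
  apply: unipotent_hom_inj => [|j]; first exact: comp.
  rewrite /= psi'E (linE _ _ _ _ hP (fun i => erefl)).
  transitivity (row j (invmx X) *m X); last first.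
    by rewrite -row_mul mulVmx // rowE mulmx1.
  by rewrite -mu1_comb; congr (mu _).1; apply: eq_bigr => i _; rewrite mxE.
move=> x y; rewrite !hE => e; apply: (can_inj psiK); exact: TI.
Qed.

Lemma eval_term_hom (h : F -> F) (n : nat) (x y : 'I_n -> F) (l : lterm k Empty_set) :
  is_lie_hom br br h -> (forall i, h (x i) = y i) -> vars_below n l ->
  h (eval_term br (fun c : Empty_set => match c with end) (env_of x) l) =
  eval_term br (fun c : Empty_set => match c with end) (env_of y) l.
Proof.
move=> hP hE; have [hD hZ hb] := hP.
elim: l => [j|[]||l1 IH1 l2 IH2|l1 IH1|l1 IH1 l2 IH2|c l1 IH1] /=.
- by move=> jn; rewrite /env_of insubT hE.
- by rewrite (lie_hom0 hP).
- by move=> [/IH1 e1 /IH2 e2]; rewrite hD e1 e2.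
- by move=> /IH1 e1; rewrite (lie_homN hP) e1.
- by move=> [/IH1 e1 /IH2 e2]; rewrite hb e1 e2.
by move=> /IH1 e1; rewrite hZ e1.
Qed.

(** Independent linear parts extend to a basis of k^r. This defines an injective endomorphism that
    sends a_i to x_i for i < n, hence l(a) to l(x). *)
Lemma free_Phi6 : Phi6 br a br.
Proof.
move=> n Hn l ln nz x /varphi_row_free; set X := mu1_mx x => freeX.
(* [f] is [X] padded with zero rows and [V] selects the first n rows; [complete_unitmx] replaces [f]
   by an invertible [g] with the same first n rows. *)
pose V : 'M[k]_(n, r) := pid_mx n; pose f : 'M[k]_r := pid_mx n *m X.
have Vf : V *m f = X.
  by rewrite mulmxA mul_pid_mx minnn (minn_idPr Hn) pid_mx_1 mul1mx.
have [|g ug Vg] := @complete_unitmx _ _ _ V f.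
  by rewrite Vf rank_pid_mx //; apply/eqP.
pose x' (j : 'I_r) := if insub (j : nat) is Some i then x i else \sum_i g j i *: a i.
case: (HF) => _ _ _ univ.
have [h [hP hE]] := univ F br brP met x'.
have hI : injective h.
  apply: free_hom_inj => //; suff -> : mu1_mx (fun i => h (a i)) = g by [].
  apply/matrixP => j i; rewrite mxE hE /x'; case: insubP => [j' jn ej|_]; last first.
    by rewrite (mu1_lin muP mu_gen) mxE.
  have := congr1 (fun M : 'M_(n, r) => M j' i) (etrans (esym Vf) Vg).
  rewrite !mxE => ->; rewrite (bigD1 j) //= !mxE ej eqxx jn mul1r big1 ?addr0 //.
  by move=> l' nl; rewrite mxE ej eq_sym val_eqE (negPf nl) mul0r.
have := eval_term_hom (n := n) (x := fun i => a (widen_ord Hn i)) (y := x) hP _ ln.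
move=> <- => [e|i]; last by rewrite hE /x' /= valK.
by apply: nz; apply: hI; rewrite e (lie_hom0 hP).
Qed.

(** Suppose the linear form Y of y is nonzero. Cancelling Y in coordinate l leaves y_l x_i = Y if l
    = i, and 0 otherwise. Taking l = 1, i = 0 gives y_1 = 0, and l = i = 1 then gives Y = 0. *)
Lemma ad_self_square y :
  (forall i, br (br y (a i)) y = 0) -> in_square br y.
Proof.
move=> Hy; apply/sqP/linX_eq0; apply/eqP/negPn/negP => nz.
have e i l : (mu y).2 l * 'X_i = (l == i)%:R * linX (mu y).1.
  have : (mu (br (br y (a i)) y)).2 l = 0 by rewrite Hy mu00 magnus20.
  rewrite mbr magnus_br2 mbr magnus_br2 (mu_gen1 mu_gen) linX_delta (mu_gen2 mu_gen).
  rewrite [X in _ - X](_ : _ = 0) ?subr0; last by rewrite linX0 mulr0.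
  by move/eqP; rewrite mulf_eq0 (negPf nz) orbF subr_eq0 => /eqP.
have r0 : (0 < r)%N by apply: leq_trans Hr.
have nzX i : 'X_i != 0 :> R by rewrite -msize_poly_eq0 msizeX mdeg1.
have ne : (Ordinal Hr == Ordinal r0) = false by [].
have := e (Ordinal r0) (Ordinal Hr); rewrite ne mul0r => /eqP.
rewrite mulf_eq0 (negPf (nzX _)) orbF => /eqP y0.
have := e (Ordinal Hr) (Ordinal Hr); rewrite y0 eqxx mul0r mul1r => /esym/eqP.
by rewrite (negPf nz).
Qed.

Lemma free_Phi'7 : Phi'7 br a br id.
Proof.
move=> m l f c cV nosol y Hy; apply: NNPP => noi; apply: nosol; exists y; split.
  by move=> j; apply: ad_self_square => i; apply: Hy.
move=> i; apply/eqP; rewrite -subr_eq0; apply/eqP; apply: NNPP => ne.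
by apply: noi; exists i.
Qed.

Lemma free_Phi'_algebra : Phi'_algebra br a br id.
Proof.
split; last by split; [apply: free_Phi6 | apply: free_Phi'7].
split=> //; [exact: free_Phi2 | exact: free_Phi3 | exact: free_Phi4 |].
by move=> f nzf z1 z2; apply: free_torsion_free => //; apply: in_square_br.
Qed.

(** Coefficients modulo F^2 are unique, so the [epsilon] choice has to agree with the linear part
    under [mu]. *)
Lemma lin_coefE u i : lin_coef br a u i = (mu u).1 0 i.
Proof.
have [al [s [Ss Es]]] := free_decomp HF u.
have : exists al : 'I_r -> k, in_square br (u - \sum_(i < r) al i *: a i).
  by exists al; rewrite Es addrC addKr; apply: (square_span_square HF).
move/(epsilon_spec (inhabits (fun _ => 0))); rewrite -/(lin_coef br a u).
move: (lin_coef br a u) => be /sqP; rewrite (lie_homB muP) /= (mu1_lin muP mu_gen).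
by move/eqP; rewrite subr_eq0 => /eqP ->; rewrite mxE.
Qed.

Lemma lin_formE u : lin_form br a u = linX (mu u).1.
Proof. by apply: eq_bigr => i _; rewrite lin_coefE. Qed.

Lemma br_lin_form y u : in_square br y -> br y u = pact y (lin_form br a u).
Proof.
move=> Vy; apply: muI; apply: magnus_ext => [|i].
  rewrite mbr; apply/esym/sqP; apply: (poly_act_closed _ _ Vy).
  exact: metabelian_act_closed.
rewrite (mu2_poly_act HF muP mu_gen _ _ Vy) mbr magnus_br2 lin_formE.
by rewrite (proj1 (sqP y) Vy) linX0 mulr0 subr0 mulrC.
Qed.

End FreeAxioms.

(** * Transfer through the universal closure *)

Section Terms.

Variables (k : fieldType) (C : Type).
Local Notation term := (lterm k C).

Definition term_sum (I : Type) (s : seq I) (G : I -> term) : term :=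
  foldr (fun i t => LAdd (G i) t) (LZero k C) s.

Definition term_poly_act r (y : term) (f : {mpoly k[r]}) (t : 'I_r -> term) : term :=
  term_sum (msupp f) (fun m => LScal f@_m
    (foldl (fun z i => iter (m i) (fun w => LBr w (t i)) z) y (enum 'I_r))).

Variables (L : lmodType k) (br : L -> L -> L) (cst : C -> L) (e : nat -> L).
Local Notation eval := (eval_term br cst e).

Lemma eval_term_sum (I : Type) (s : seq I) (G : I -> term) :
  eval (term_sum s G) = \sum_(i <- s) eval (G i).
Proof. by elim: s => [|i s IH] /=; rewrite ?big_nil // big_cons IH. Qed.

Lemma eval_term_poly_act r y (f : {mpoly k[r]}) (t : 'I_r -> term) :
  eval (term_poly_act y f t) = poly_act br (eval y) f (fun i => eval (t i)).
Proof.
rewrite eval_term_sum; apply: eq_bigr => m _ /=; congr (_ *: _).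
rewrite /mono_act; elim: (enum _) y => //= i s IH y; rewrite IH; congr foldl.
by elim: (m i) => //= n ->.
Qed.

Lemma holds_foldr_and (I : eqType) (s : seq I) (G : I -> qform k C) q :
  holds br cst e (foldr (fun i q' => QAnd (G i) q') q s) <->
  (forall i, i \in s -> holds br cst e (G i)) /\ holds br cst e q.
Proof.
elim: s => [|i s IH] /=; first by split=> [|[]].
split=> [[Hi /IH[Hs Hq]]|[H Hq]].
  by split=> // j; rewrite in_cons => /predU1P[->//|/Hs].
split; first by apply: H; rewrite mem_head.
by apply/IH; split=> // j sj; apply: H; rewrite in_cons sj orbT.
Qed.

End Terms.

Fixpoint term_of_pure (k : fieldType) (C : Type) (t : lterm k Empty_set) : lterm k C :=
  match t with
  | LVar j => LVar k C j
  | LCst c => match c with end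
  | LZero => LZero k C
  | LAdd t1 t2 => LAdd (term_of_pure C t1) (term_of_pure C t2)
  | LOpp t1 => LOpp (term_of_pure C t1)
  | LBr t1 t2 => LBr (term_of_pure C t1) (term_of_pure C t2)
  | LScal c t1 => LScal c (term_of_pure C t1)
  end.

Lemma eval_term_of_pure (k : fieldType) (C : Type) (L : lmodType k) (br : L -> L -> L)
    (cst : C -> L) (e : nat -> L) n (x : 'I_n -> L) (t : lterm k Empty_set) :
  (forall i : 'I_n, e i = x i) -> vars_below n t ->
  eval_term br cst e (term_of_pure C t) =
  eval_term br (fun c : Empty_set => match c with end) (env_of x) t.
Proof.
move=> ex; elim: t => [j|[]||t1 IH1 t2 IH2|t1 IH1|t1 IH1 t2 IH2|c t1 IH1] //=.
- by move=> jn; rewrite /env_of insubT -ex.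
- by move=> [/IH1 -> /IH2 ->].
- by move=> /IH1 ->.
- by move=> [/IH1 -> /IH2 ->].
by move=> /IH1 ->.
Qed.

Section UniversalClosure.

Variables (k : finFieldType) (r : nat) (F : lmodType k) (brF : F -> F -> F).
Variable a : 'I_r -> F.
Variables (A : lmodType k) (brA : A -> A -> A) (iota : F -> A).
Local Notation evalA := (eval_term brA iota).
Local Notation evalF := (eval_term brF id).
Hypothesis ucl : in_ucl brF brA iota.

(** If the system had no solution in F, the universal sentence denying it would hold in F and hence
    in A. *)
Lemma ucl_transfer (I J : finType) (E : I -> lterm k F) (N : J -> lterm k F) (e : nat -> A) :
  (forall i, evalA e (E i) = 0) -> (forall j, evalA e (N j) <> 0) ->
  exists e' : nat -> F, (forall i, evalF e' (E i) = 0) /\ (forall j, evalF e' (N j) <> 0).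
Proof.
move=> HE HN; apply: NNPP => no.
pose q := foldr (fun i q => QAnd (QEq (E i) (LZero k F)) q)
  (foldr (fun j q => QAnd (QNot (QEq (N j) (LZero k F))) q)
    (QEq (LZero k F) (LZero k F)) (enum J)) (enum I).
have /ucl/(_ e) : univ_holds brF id (QNot q).
  move=> e' /= /holds_foldr_and[HEe /holds_foldr_and[HNe _]]; apply: no; exists e'.
  by split=> [i|j]; [apply: HEe | apply: HNe]; rewrite mem_enum.
apply; apply/holds_foldr_and; split=> [i _|]; first exact: HE.
by apply/holds_foldr_and; split=> // j _; apply: HN.
Qed.

(* The negation of Fit (sum_i alpha_i x_i), with one witness variable
   [n + pickle alpha] for every coefficient vector: there are only finitely
   many because k is finite. *)
Definition nonFit_term n (alpha : {ffun 'I_n -> k}) : lterm k F :=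
  let S := term_sum (enum 'I_n) (fun i => LScal (alpha i) (LVar k F i)) in
  LBr (LBr S (LVar k F (n + pickle alpha))) S.

Lemma varphi_env n (x : 'I_n -> A) : varphi brA x -> exists e : nat -> A,
  (forall i : 'I_n, e i = x i) /\
  forall alpha : {ffun 'I_n -> k}, alpha != 0 -> evalA e (nonFit_term alpha) <> 0.
Proof.
move=> Hx.
have wit (alpha : {ffun 'I_n -> k}) : exists y, alpha != 0 ->
    brA (brA (\sum_i alpha i *: x i) y) (\sum_i alpha i *: x i) <> 0.
  have [->|nz] := eqVneq alpha 0; first by exists 0.
  have [|y Hy] := not_all_ex_not _ _ (Hx alpha _); last by exists y.
  apply: NNPP => no; case/eqP: nz; apply/ffunP => i; rewrite ffunE.
  by apply/eqP/negPn/negP => nzi; apply: no; exists i.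
pose y alpha := sval (constructive_indefinite_description _ (wit alpha)).
have yP alpha := svalP (constructive_indefinite_description _ (wit alpha)).
(* Variables below n hold the tuple, variable [n + pickle alpha] holds the witness for [alpha], any
   other is 0. *)
pose e j := if insub j : option 'I_n is Some i then x i 
  else if unpickle (j - n)%N is Some alpha then y alpha else 0.
have ex (i : 'I_n) : e i = x i by rewrite /e valK.
exists e; split=> // alpha /yP; rewrite /= eval_term_sum big_enum /=.
have -> : e (n + pickle alpha)%N = y alpha.
  by rewrite /e insubF ?addKn ?pickleK //= ltnNge leq_addr.
by under [in X in _ -> X]eq_bigr do rewrite /= ex.
Qed.

Lemma env_varphi n (e : nat -> F) :
  (forall alpha : {ffun 'I_n -> k}, alpha != 0 -> evalF e (nonFit_term alpha) <> 0) ->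
  varphi brF (fun i : 'I_n => e i).
Proof.
move=> He alpha [i nzi] Fit; pose al := [ffun j => alpha j].
apply: (He al).
  by apply/eqP => /ffunP/(_ i); rewrite !ffunE => ai; rewrite ai eqxx in nzi.
rewrite /= eval_term_sum big_enum /=.
by under eq_bigr do rewrite /= ffunE; apply: Fit.
Qed.

Lemma ucl_varphi n (x : 'I_n -> A) (t : lterm k F) : varphi brA x -> exists e : nat -> A,
  (forall i : 'I_n, e i = x i) /\
  (evalA e t = 0 -> exists e' : nat -> F,
    varphi brF (fun i : 'I_n => e' i) /\ evalF e' t = 0).
Proof.
move=> /varphi_env[e [ex He]]; exists e; split=> // et.
have [e' [et' He']] := @ucl_transfer unit {alpha : {ffun 'I_n -> k} | alpha != 0}
  (fun=> t) (fun alpha => nonFit_term (val alpha)) e (fun=> et) (fun j => He _ (valP j)).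
exists e'; split; last exact: (et' tt).
by apply: env_varphi => alpha nz; apply: (He' (Sub alpha nz)).
Qed.

Let v j := LVar k F j.

(** A failure of an axiom in A is a finite system of equations and inequations; its transfer to F
    contradicts the axiom there. *)
Lemma ucl_Phi'_algebra : Phi'_algebra brF a brF id -> Phi'_algebra brF a brA iota.
Proof.
case=> [[F1 F2 F3 F4 F5] [F6 F7]]; split; [split | split].
- move=> x1 x2 x3 x4; apply: NNPP => ne.
  have [|e [_ /(_ tt) []]] := @ucl_transfer void unit (fun=> v 0)
    (fun=> LBr (LBr (v 0) (v 1)) (LBr (v 2) (v 3))) (nth 0 [:: x1; x2; x3; x4]) _ (fun=> ne).
    by case.
  exact: F1.
- move=> x y xyx xyy; apply: NNPP => ne.
  (* The boolean is coerced to the variable index 0 or 1, so one family states both equations. *)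
  have [|e [He /(_ tt) []]] := @ucl_transfer bool unit
    (fun b => LBr (LBr (v 0) (v 1)) (v b)) (fun=> LBr (v 0) (v 1)) (nth 0 [:: x; y]) _ (fun=> ne).
    by case.
  exact: (F2 _ _ (He false) (He true)).
- move=> x y z nzx xy xz; apply: NNPP => ne.
  have [||e [He He']] := @ucl_transfer bool bool
    (fun b => LBr (v 0) (v b.+1)) (fun b => if b then v 0 else LBr (v 1) (v 2)) (nth 0 [:: x; y; z]).
  + by case.
  + by case.
  by apply: (He' false); apply: F3 (He' true) (He false) (He true).
- move=> x /(@ucl_varphi _ _ (LZero k F))[e [_ /(_ erefl)[e' [/F4]]]] //.
- move=> f nzf z1 z2 f0; apply: NNPP => ne.
  have [|e [/(_ tt) He /(_ tt) []]] := @ucl_transfer unit unit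
    (fun=> term_poly_act (LBr (v 0) (v 1)) f (fun i => LCst k (a i)))
    (fun=> LBr (v 0) (v 1)) (nth 0 [:: z1; z2]) _ (fun=> ne).
    by move=> _; rewrite eval_term_poly_act.
  by apply: (F5 f nzf); rewrite eval_term_poly_act in He.
- move=> n Hn l ln nz x Hx lx.
  have [e [ex]] := @ucl_varphi _ x (term_of_pure F l) Hx.
  rewrite (eval_term_of_pure _ _ ex ln) => /(_ lx) [e' [He']].
  rewrite (@eval_term_of_pure k F F brF id e' n (fun i => e' i) l) //.
  exact: F6 nz _ He'.
move=> m l f c cV nosol y Hy; apply: NNPP => no.
have h0 i : \sum_(j < l) poly_act brA (y j) (f i j) (fun i0 => iota (a i0)) - iota (c i) = 0.
  by apply: NNPP => ne; apply: no; exists i.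
pose E (p : ('I_l * 'I_r) + 'I_m) := match p with
  | inl ji => LBr (LBr (v ji.1) (LCst k (a ji.2))) (v ji.1)
  | inr i => LAdd (term_sum (enum 'I_l) (fun j => term_poly_act (v j) (f i j) (fun i0 => LCst k (a i0))))
      (LOpp (LCst k (c i)))
  end.
pose e j := if insub j : option 'I_l is Some i then y i else 0.
have ey (j : 'I_l) : e j = y j by rewrite /e valK.
have [||e' [He' _]] := @ucl_transfer _ void E (fun=> v 0) e; last first.
- case: (F7 m l f c cV nosol (fun j => e' j)) => [j i|i []]; first exact: (He' (inl (j, i))).
  have := He' (inr i); rewrite /= eval_term_sum big_enum /= => Hi; rewrite -[RHS]Hi; congr (_ + _).
  by apply: eq_big => [//|j _]; rewrite eval_term_poly_act.
- by case.
case=> [[j i]|i] /=; first by rewrite ey; apply: Hy.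
rewrite eval_term_sum big_enum /= -[RHS](h0 i); congr (_ + _).
by apply: eq_big => [//|j _]; rewrite eval_term_poly_act /= ey.
Qed.

End UniversalClosure.

(** * Extensions by torsion-free modules *)

Section TorsionFree.

Variables (R : idomainType) (M : lmodType R).

(** Coefficients live on [nat], so that passing to [x :: b] is a shift without casts between
    ordinals. *)
Definition independent (b : seq M) : Prop := forall g : nat -> R,
  \sum_(i < size b) g i *: b`_i = 0 -> forall i, (i < size b)%N -> g i = 0.

Lemma span_nat_sum (b : seq M) x : span b x ->
  exists g : nat -> R, x = \sum_(i < size b) g i *: b`_i.
Proof.
case/span_sum => g ->; exists (fun j => if insub j is Some i then g i else 0).
by apply: eq_bigr => i _; rewrite valK.
Qed.

Lemma span_of_sum (b : seq M) (g : nat -> R) : span b (\sum_(i < size b) g i *: b`_i).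
Proof.
apply: (@submodule_sum _ _ (span b)) => [|i _]; first exact: span_submodule.
by apply: (@submoduleZ _ _ (span b)); [apply: span_submodule | exact: (mem_span (mem_nth 0 (ltn_ord i)))].
Qed.

(** Greedy choice: an element with a nonzero multiple in the current span only changes [d]; any
    other joins the independent family. *)
Lemma independent_multiple (s : seq M) : exists b d,
  [/\ independent b, d != 0 & forall x, x \in s -> span b (d *: x)].
Proof.
elim: s => [|x s [b [d [ib nzd Hd]]]]; first by exists [::], 1; split; rewrite ?oner_eq0.
case: (excluded_middle_informative (exists2 e, e != 0 & span b (e *: x))) => [[e nze He]|no].
  exists b, (d * e); split=> //; first by rewrite mulf_neq0.
  move=> y; rewrite in_cons => /predU1P[->|/Hd Hy].
    by rewrite -scalerA; apply: (@submoduleZ _ _ (span b)) => //; apply: span_submodule.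
  by rewrite mulrC -scalerA; apply: (@submoduleZ _ _ (span b)) => //; apply: span_submodule.
have sub y : span b y -> span (x :: b) y.
  move/(_ _ (span_submodule (x :: b))); apply=> z bz.
  by apply: mem_span; rewrite in_cons bz orbT.
exists (x :: b), d; split=> //.
  move=> g /=; rewrite big_ord_recl /= => e.
  rewrite (eq_bigr (fun i : 'I_(size b) => g i.+1 *: b`_i)) // in e.
  have g0 : g 0%N = 0.
    apply/eqP/negPn/negP => nz; apply: no; exists (g 0%N) => //.
    move/eqP: e; rewrite addr_eq0 => /eqP ->; rewrite -scaleN1r.
    by apply: (@submoduleZ _ _ (span b)); [apply: span_submodule | exact: (@span_of_sum b (fun i => g i.+1))].
  by case=> // i; apply: (ib (g \o S)); rewrite -[RHS]e g0 scale0r add0r.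
move=> y; rewrite in_cons => /predU1P[->|/Hd/sub //].
by apply: (@submoduleZ _ _ (span (x :: b))); [apply: span_submodule | exact: (mem_span (mem_head _ _))].
Qed.

(** If [g t 0] is nonzero, at most one [x m] is bad for [t]; [p 0] is some [x N] beyond all of
    these. The induction hypothesis, for [B] translated by [g t 0 * x N], settles every [t] with a
    later nonzero coefficient. *)
Lemma avoid_values (x : nat -> R) (T : Type) (D : seq T) (g : T -> nat -> R)
    (B : T -> R -> Prop) n :
  injective x -> (forall t c c', B t c -> B t c' -> c = c') ->
  exists p : nat -> R, forall t, List.In t D ->
    (exists2 i, (i < n)%N & g t i != 0) -> ~ B t (\sum_(i < n) g t i * p i).
Proof.
move=> injx; elim: n g B => [|n IH] g B uB; first by exists (fun=> 0) => t _ [].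
have [N HN] : exists N, forall t, List.In t D -> g t 0%N != 0 ->
    forall m, (N <= m)%N -> ~ B t (g t 0%N * x m).
  elim: D {IH} => [|t D [N HN]]; first by exists 0%N.
  case: (excluded_middle_informative (exists m, B t (g t 0%N * x m))) => [[m0 Bm0]|no].
    exists (maxn N m0.+1) => t' [<-|Dt'] nz m; rewrite geq_max => /andP[Nm m0m].
      move=> /(uB _ _ _ Bm0)/(mulfI nz)/injx e; by rewrite e ltnn in m0m.
    exact: HN.
  exists N => t' [<-|Dt'] nz m Nm; last exact: HN.
  by move=> Bm; apply: no; exists m.
have [|p Hp] := IH (fun t i => g t i.+1) (fun t c => B t (g t 0%N * x N + c)).
  by move=> t c c' /uB H /H /addrI.
exists (fun i => if i is i'.+1 then p i' else x N) => t Dt [i iN nz].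
rewrite big_ord_recl /=.
case: (excluded_middle_informative (exists2 i, (i < n)%N & g t i.+1 != 0)) => [|no].
  exact: Hp.
case: i iN nz => [_ nz|i iN nz]; last by case: no; exists i.
rewrite big1 ?addr0 => [|i' _]; first exact: HN.
suff -> : g t (bump 0 i') = 0 by rewrite mul0r.
by apply/eqP/negPn/negP => nzi; apply: no; exists i'.
Qed.

(* After multiplication by d, the module embeds in a free module; a generic
   linear form on the latter avoids finitely many prescribed values. *)
Lemma separating_form (s : seq M) (x : nat -> R) (T : Type) (D : seq T) (m : T -> M)
    (B : T -> R -> Prop) :
  (forall a (y : M), a != 0 -> a *: y = 0 -> y = 0) -> (forall y, span s y) ->
  injective x -> (forall t c c', B t c -> B t c' -> c = c') ->
  exists lam : M -> R, (forall a y z, lam (a *: y + z) = a * lam y + lam z) /\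
    forall t, List.In t D -> m t <> 0 -> ~ B t (lam (m t)).
Proof.
move=> tf gens injx uB; have [b [d [ib nzd Hd]]] := independent_multiple s.
have coord y : exists g : nat -> R, d *: y = \sum_(i < size b) g i *: b`_i.
  apply: span_nat_sum; apply: (gens y (fun z => span b (d *: z))) => //.
  split=> [|a u v Hu Hv]; first by rewrite scaler0; case: (span_submodule b).
  rewrite scalerDr scalerA mulrC -scalerA.
  by case: (span_submodule b) => _; apply.
pose G y := sval (constructive_indefinite_description _ (coord y)).
have GP y : d *: y = \sum_(i < size b) G y i *: b`_i.
  exact: (svalP (constructive_indefinite_description _ (coord y))).
(* The coordinates were chosen arbitrarily; independence of [b] makes them unique, hence linear. *)
have Glin a y z i : (i < size b)%N -> G (a *: y + z) i = a * G y i + G z i.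
  move=> lt_i; apply/eqP; rewrite -subr_eq0; apply/eqP.
  apply: (ib (fun i => G (a *: y + z) i - (a * G y i + G z i))) lt_i.
  rewrite (eq_bigr (fun i : 'I__ => G (a *: y + z) i *: b`_i - (a *: (G y i *: b`_i) + G z i *: b`_i))).
    rewrite sumrB big_split /= -scaler_sumr -!GP scalerDr !scalerA mulrC.
    by rewrite -!scalerA subrr.
  by move=> j _; rewrite scalerBl scalerDl scalerA.
have [p Hp] := @avoid_values x T D (fun t => G (m t)) B (size b) injx uB.
exists (fun y => \sum_(i < size b) G y i * p i); split=> [a y z|t Dt nz].
  by rewrite mulr_sumr -big_split; apply: eq_bigr => i _ /=; rewrite Glin // mulrDl mulrA.
apply: Hp => //; apply: NNPP => no; apply: nz; apply: (tf d) => //.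
rewrite GP big1 // => i _; suff -> : G (m t) i = 0 by rewrite scale0r.
by apply/eqP/negPn/negP => nzi; apply: no; exists i.
Qed.

End TorsionFree.

(** * Discrimination by homomorphisms to F *)

Section Discrimination.

Variables (k : fieldType) (F : lmodType k) (brF : F -> F -> F).
Variables (A : lmodType k) (brA : A -> A -> A) (iota : F -> A).

Fixpoint atom_values (e : nat -> A) (f : qform k F) : seq A :=
  match f with
  | QEq t1 t2 => [:: eval_term brA iota e t1 - eval_term brA iota e t2]
  | QNot g => atom_values e g
  | QAnd g h => atom_values e g ++ atom_values e h
  | QOr g h => atom_values e g ++ atom_values e h
  end.

Lemma holds_hom (h : A -> F) e f : is_lie_hom brA brF h -> (forall u, h (iota u) = u) ->
  (forall d, d \in atom_values e f -> h d = 0 -> d = 0) ->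
  holds brA iota e f <-> holds brF id (h \o e) f.
Proof.
move=> hP hi; have [hD hZ hb] := hP.
have ev t : h (eval_term brA iota e t) = eval_term brF id (h \o e) t.
  elim: t => //= [|t1 <- t2 <-|t <-|t1 <- t2 <-|c t <-] //.
  - exact: (lie_hom0 hP).
  - exact: (lie_homN hP).
elim: f => [t1 t2|g IH|g1 IH1 g2 IH2|g1 IH1 g2 IH2] /= H.
- rewrite -!ev; split=> [-> //|et].
  apply/eqP; rewrite -subr_eq0; apply/eqP; apply: H; first by rewrite mem_head.
  by rewrite (lie_homB hP) et subrr.
- by split=> Hn /(IH H).
- have [] := (IH1, IH2); case=> [d Hd|]; first by apply: H; rewrite mem_cat Hd.
  move=> a1 b1; case=> [d Hd|a2 b2]; first by apply: H; rewrite mem_cat Hd orbT.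
  by split=> [[/a1 ? /a2 ?]|[/b1 ? /b2 ?]].
have [] := (IH1, IH2); case=> [d Hd|]; first by apply: H; rewrite mem_cat Hd.
move=> a1 b1; case=> [d Hd|a2 b2]; first by apply: H; rewrite mem_cat Hd orbT.
by split=> [[/a1|/a2]|[/b1|/b2]]; [left|right|left|right].
Qed.

(** The truth of a quantifier-free formula at [e] depends only on which of its finitely many atom
    differences vanish, and a suitable [h] preserves exactly that. *)
Lemma discriminated_in_ucl :
  (forall D : seq A, exists h : A -> F, [/\ is_lie_hom brA brF h,
     forall u, h (iota u) = u & forall d, d \in D -> h d = 0 -> d = 0]) ->
  in_ucl brF brA iota.
Proof.
move=> H f Hf e; have [h [hP hi hD]] := H (atom_values e f).
exact/(holds_hom hP hi hD)/Hf.
Qed.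

End Discrimination.

Section ExtensionInUcl.

Variables (k : fieldType) (r : nat) (F : lmodType k) (br : F -> F -> F).
Variable a : 'I_r -> F.
Hypothesis HF : is_free_metabelian br a.
Hypothesis Hr : (2 <= r)%N.
Local Notation R := {mpoly k[r]}.
Local Notation pact y f := (poly_act br y f a).

Variable mu : F -> magnus k r.
Hypothesis muP : is_lie_hom br (@magnus_br k r) mu.
Hypothesis mu_gen : forall i, mu (a i) = (delta_mx 0 i, [ffun j => (j == i)%:R]).

Variables (A : lmodType k) (brA : A -> A -> A) (iota : F -> A).
Hypothesis Hfg : fin_generated brA.
Variables (M : lmodType R) (phi : F * M -> A).
Hypothesis tfM : torsion_free M.
Hypothesis phiP : is_Fr_iso br a brA iota phi.

(** The M-component of a bracket is an R-combination of those of its arguments, so the M-components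
    of Lie generators span. *)
Lemma extension_fin_generated : exists s : seq M, forall y, span s y.
Proof.
case: phiP => [[psi phiK psiK] phiD phiZ phib _]; have [s Hs] := Hfg.
pose sM := [seq (psi x).2 | x <- s]; exists sM => y.
have [s0 sD] := span_submodule sM.
rewrite -[y]/((0, y) : F * M).2 -(phiK (0, y)).
apply: (Hs (fun x => span sM (psi x).2)).
- suff -> : psi 0 = (0, 0) by [].
  by rewrite -(phiK (0, 0)) -(scale0r (phi (0, 0))) -phiZ /= !scaler0.
- move=> u v Hu Hv; rewrite -(psiK u) -(psiK v) -phiD phiK /=.
  by rewrite -[(psi u).2]scale1r; apply: sD.
- move=> c u Hu; rewrite -(psiK u) -phiZ phiK /=.
  by apply: (@submoduleZ _ _ (span sM)); first exact: span_submodule.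
- move=> u v Hu Hv; rewrite -(psiK u) -(psiK v) -phib phiK /= -scaleNr addrC.
  by apply: sD => //; apply: (@submoduleZ _ _ (span sM)) => //; apply: span_submodule.
by move=> x /List_In_mem sx; apply: mem_span; apply/mapP; exists x.
Qed.

Lemma extension_in_ucl : in_ucl br brA iota.
Proof.
have brP : is_lie br by case: HF.
have met : metabelian br by case: HF.
have sqP := metabelian_act_closed a brP met.
apply: discriminated_in_ucl => D.
case: (phiP) => [[psi phiK psiK] phiD phiZ phib phii].
have [s gens] := extension_fin_generated.
have [w [i0 [Vw nzw]]] := exists_square_neq0 Hr muP mu_gen.
have w0 : w <> 0 by move=> e; move: nzw; rewrite e (mu0 muP) magnus20 eqxx.
have injw c c' : pact w c = pact w c' -> c = c'.
  move=> e; apply/eqP; rewrite -subr_eq0; apply/negPn/negP => nz.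
  apply: w0; apply: (free_torsion_free HF muP mu_gen Vw nz).
  by rewrite poly_actDr poly_actNr e subrr.
(* The condition [B] says that the map below kills x; by [injw] it holds for at most one value. The
   powers of one variable are an infinite supply of values over any field. *)
have [||lam [lamP Hlam]] := @separating_form _ M s (fun n => 'X_[U_(i0) *+ n]) A D
  (fun x => (psi x).2) (fun x c => (psi x).1 + pact w c = 0) tfM gens.
- move=> n n' e; have := congr1 (mcoeff (U_(i0) *+ n)%MM) e.
  rewrite /= !mcoeffX eqxx; case: eqP => [/(congr1 (@mdeg r))|_ /eqP]; last by rewrite oner_eq0.
  by rewrite !mdegMn !mdeg1 !mul1n.
- by move=> t c c' e e'; apply: injw; apply: (@addrI _ (psi t).1); rewrite e e'.
have lam0 : lam 0 = 0.
  by have := lamP (-1) 0 0; rewrite scaler0 addr0 mulN1r addNr.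
have lamD y z : lam (y + z) = lam y + lam z by have := lamP 1 y z; rewrite scale1r mul1r.
have lamZ c y : lam (c *: y) = c * lam y by have := lamP c y 0; rewrite lam0 !addr0.
have psi_phi p x : x = phi p -> psi x = p by move=> ->.
(* Identity on F and m to w . lam(m) on M. Brackets are respected because [lam] is R-linear and the
   image of M lies in the abelian F^2. *)
exists (fun x => (psi x).1 + pact w (lam (psi x).2)); split.
- split=> [x y|c x|x y].
  + have -> : psi (x + y) = ((psi x).1 + (psi y).1, (psi x).2 + (psi y).2).
      by apply: psi_phi; rewrite phiD !psiK.
    by rewrite /= lamD poly_actDr addrACA.
  + have -> : psi (c *: x) = (c *: (psi x).1, c%:MP *: (psi x).2).
      by apply: psi_phi; rewrite phiZ psiK.
    by rewrite /= lamZ mul_mpolyC poly_actZr scalerDr.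
  have -> : psi (brA x y) = dme_br br a (psi x) (psi y).
    by apply: psi_phi; rewrite phib !psiK.
  move: (psi x) (psi y) => [u m] [v n] /=.
  have Vp c : in_square br (pact w c) by apply: poly_act_closed.
  rewrite -scaleNr addrC lamP addrC lamZ (brDl brP) !(brDr brP).
  rewrite [br (pact w _) (pact w _)](metabelian_square brP met) // addr0.
  rewrite (brC brP u (pact _ _)).
  rewrite (br_lin_form HF muP mu_gen v (Vp (lam m))) (br_lin_form HF muP mu_gen u (Vp (lam n))).
  rewrite -!(poly_actM brP sqP) // mulNr poly_actDr poly_actNr.
  rewrite [_ * lam m]mulrC [_ * lam n]mulrC -addrA; congr (_ + _); exact: addrC.
- move=> u; rewrite -phii phiK /= lam0; by rewrite poly_act0r addr0.
move=> d Dd e; case: (eqVneq (psi d).2 0) => [m0|/eqP m0].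
  rewrite -(psiK d) [psi d]surjective_pairing m0; move: e.
  rewrite m0 lam0 poly_act0r addr0 => ->.
  by rewrite -(scale0r (phi (0, 0))) -phiZ /= !scaler0.
by case: (Hlam d (mem_List_In Dd) m0).
Qed.

End ExtensionInUcl.

(** * Structure of the algebras satisfying the axioms *)

Section PhiToExtension.

Variables (k : fieldType) (r : nat) (F : lmodType k) (br : F -> F -> F).
Variable a : 'I_r -> F.
Hypothesis HF : is_free_metabelian br a.
Hypothesis Hr : (2 <= r)%N.
Local Notation R := {mpoly k[r]}.

Variable mu : F -> magnus k r.
Hypothesis muP : is_lie_hom br (@magnus_br k r) mu.
Hypothesis mu_gen : forall i, mu (a i) = (delta_mx 0 i, [ffun j => (j == i)%:R]).

Variables (A : lmodType k) (brA : A -> A -> A) (iota : F -> A).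
Hypothesis HA : is_lie brA.
Hypothesis iotaP : is_lie_hom br brA iota.
Hypothesis iota_inj : injective iota.
Hypothesis metA : metabelian brA.
Hypothesis Hfg : fin_generated brA.
Hypothesis phi2 : Phi2 brA.
Hypothesis phi3 : Phi3 brA.
Hypothesis phi4 : Phi4 r brA.
Hypothesis phi5 : Phi'5 a brA iota.
Hypothesis phi7 : Phi'7 br a brA iota.

Local Notation t := (fun i => iota (a i)).
Local Notation pact y f := (poly_act brA y f t).
Local Notation Fit := (FitEl brA).

Let brP : is_lie br. Proof. by case: HF. Qed.
Let met : metabelian br. Proof. by case: HF. Qed.
Let sqP u : in_square br u <-> (mu u).1 = 0 := squareP HF muP mu_gen u.
Let iota0 : iota 0 = 0 := lie_hom0 iotaP.
Let iotaD x y : iota (x + y) = iota x + iota y. Proof. by case: iotaP. Qed.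
Let iotaZ c x : iota (c *: x) = c *: iota x. Proof. by case: iotaP. Qed.
Let iota_br x y : iota (br x y) = brA (iota x) (iota y). Proof. by case: iotaP. Qed.

Lemma iota_eq0 u : iota u = 0 -> u = 0.
Proof. by rewrite -iota0 => /iota_inj. Qed.

(** [Phi2] applies: xzx = 0 as x is in Fit, and xzz = 0 as A^2 is abelian. *)
Lemma Fit_square x z : Fit x -> in_square brA z -> brA x z = 0.
Proof.
move=> Fx Vz; apply: phi2; first exact: Fx.
by apply: (metabelian_square HA metA) => //; apply: in_square_br.
Qed.

Lemma square_Fit z : in_square brA z -> Fit z.
Proof.
by move=> Vz y; apply: (metabelian_square HA metA) => //; apply: in_square_br.
Qed.

Lemma exists_square_iota : exists2 w, in_square br w & iota w <> 0.
Proof.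
have [w [i [Vw nzw]]] := exists_square_neq0 Hr muP mu_gen; exists w => //.
by move=> /iota_eq0 e; move: nzw; rewrite e (mu0 muP) magnus20 eqxx.
Qed.

(** Both elements commute with a nonzero element of the image of F^2, so [Phi3] applies. *)
Lemma Fit_abelian x y : Fit x -> Fit y -> brA x y = 0.
Proof.
move=> Fx Fy; have [w Vw nzw] := exists_square_iota.
have Vw' := lie_hom_square iotaP Vw.
by apply: (phi3 nzw); rewrite brC // Fit_square ?oppr0.
Qed.

(** The condition defining Fit is quadratic in x; as the annihilator of A^2 it is visibly a
    subspace. *)
Lemma FitP x : Fit x <-> forall z, in_square brA z -> brA x z = 0.
Proof.
split=> [Fx z|H y]; first exact: Fit_square.
by rewrite brC // H ?oppr0 //; apply: in_square_br.
Qed.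

Lemma Fit_act_closed : act_closed brA t Fit.
Proof.
split.
- by apply/FitP => z _; rewrite br0l.
- by move=> x y /FitP Fx /FitP Fy; apply/FitP => z Vz; rewrite brDl // Fx // Fy // addr0.
- by move=> c x /FitP Fx; apply/FitP => z Vz; rewrite brZl // Fx // scaler0.
- by move=> x i _; apply/square_Fit/in_square_br.
move=> x i j Fx; rewrite br_swap // [X in _ + X]Fit_square ?addr0 //.
exact: in_square_br.
Qed.

Let FitD x y : Fit x -> Fit y -> Fit (x + y).
Proof. by case: Fit_act_closed => _ + _ _ _; apply. Qed.
Let FitZ c x : Fit x -> Fit (c *: x).
Proof. by case: Fit_act_closed => _ _ + _ _; apply. Qed.
Let FitN x : Fit x -> Fit (- x). Proof. by rewrite -scaleN1r; apply: FitZ. Qed.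

Lemma Fit_iota u : Fit (iota u) <-> in_square br u.
Proof.
split=> [Fu|/(lie_hom_square iotaP)/square_Fit //].
apply/(FitEl_square HF Hr muP mu_gen) => y; apply: iota_inj.
by rewrite !iota_br Fu iota0.
Qed.

Lemma Fit_lin (al : 'I_r -> k) : Fit (\sum_i al i *: t i) -> forall i, al i = 0.
Proof.
have -> : \sum_i al i *: t i = iota (\sum_i al i *: a i).
  by rewrite (lie_hom_sum iotaP); apply: eq_bigr => i _; rewrite iotaZ.
move/Fit_iota/sqP; rewrite (mu1_lin muP mu_gen) => /rowP e i.
by have := e i; rewrite !mxE.
Qed.

(** [Phi4] for x, a_1, ..., a_r puts a nontrivial combination into Fit; x occurs in it because the
    a_i are independent modulo Fit. *)
Lemma Fit_decomp x : exists (al : 'I_r -> k) w, Fit w /\ x = \sum_i al i *: t i + w.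
Proof.
pose y (i : 'I_r.+1) := if unlift ord0 i is Some j then t j else x.
have [al [[i nzi] Fy]] : exists al : 'I_r.+1 -> k,
    (exists i, al i != 0) /\ Fit (\sum_i al i *: y i).
  apply: NNPP => no; apply: (phi4 (x := y)) => al nz Fal.
  by apply: no; exists al.
move: Fy; rewrite big_ord_recl /= {1}/y unlift_none.
rewrite (eq_bigr (fun i => al (lift ord0 i) *: t i)) => [Fy|j _]; last by rewrite /y liftK.
have nz0 : al ord0 != 0.
  apply/eqP => a0; move: Fy; rewrite a0 scale0r add0r => /Fit_lin al0.
  case: (unliftP ord0 i) nzi => [j|] ->; by rewrite ?a0 ?al0 eqxx.
exists (fun i => - (al ord0)^-1 * al (lift ord0 i)),
  ((al ord0)^-1 *: (al ord0 *: x + \sum_i al (lift ord0 i) *: t i)).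
split; first exact: FitZ.
rewrite scalerDr scalerA mulVf // scale1r scaler_sumr addrCA -big_split /=.
by rewrite big1 ?addr0 // => j _; rewrite mulNr scaleNr scalerA addNr.
Qed.

(** [Phi'5] concerns products only, so it is applied to the m a_i, which f kills too. If m were
    nonzero with all m a_i = 0, [Phi3] would make the a_i commute and F^2 vanish. *)
Lemma Fit_torsion_free (f : R) m : Fit m -> f != 0 -> pact m f = 0 -> m = 0.
Proof.
move=> Fm nzf mf; apply: NNPP => nzm.
have mt i : brA m (t i) = 0.
  by apply: (phi5 nzf); rewrite (poly_act_brl HA Fit_act_closed) // mf br0l.
have [w [i [[f' ->] nzw]]] : exists w i, square_span br a w /\ (mu w).2 i != 0.
  have [w [i [Vw nzw]]] := exists_square_neq0 Hr muP mu_gen; exists w, i; split=> //.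
  exact/(square_spanP HF muP mu_gen)/sqP.
case/eqP: nzw; suff -> : \sum_i \sum_j poly_act br (br (a i) (a j)) (f' i j) a = 0.
  by rewrite (mu0 muP) magnus20.
rewrite big1 // => l _; rewrite big1 // => j _.
have -> : br (a l) (a j) = 0; last by rewrite poly_act0l.
by apply: iota_eq0; rewrite iota_br; apply: phi3 nzm (mt l) (mt j).
Qed.

Lemma br_Fit_lin_form m u : Fit m -> brA m (iota u) = pact m (lin_form br a u).
Proof.
move=> Fm; have [al [s [Ss ->]]] := free_decomp HF u.
have Vs := square_span_square HF Ss.
rewrite (lin_formE HF muP mu_gen) (muD muP) iotaD (brDr HA).
rewrite (Fit_square Fm (lie_hom_square iotaP Vs)) addr0 /=.
rewrite (proj1 (sqP s) Vs) addr0 (mu1_lin muP mu_gen) (lie_hom_sum iotaP).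
rewrite (eq_bigr (fun i => al i *: t i)) => [|i _]; last exact: iotaZ.
by rewrite br_lin //; congr poly_act; apply: eq_bigr => i _; rewrite mxE.
Qed.

Definition combination l (w : 'I_l -> A) (g : 'I_l -> R) : A := \sum_j pact (w j) (g j).

Lemma combinationD l (w : 'I_l -> A) g h :
  combination w g + combination w h = combination w (fun j => g j + h j).
Proof. by rewrite -big_split; apply: eq_bigr => j _; rewrite poly_actDr. Qed.

Lemma combinationZ l (w : 'I_l -> A) c g :
  c *: combination w g = combination w (fun j => c *: g j).
Proof. by rewrite scaler_sumr; apply: eq_bigr => j _; rewrite poly_actZr. Qed.

Lemma poly_act_combination l (w : 'I_l -> A) g f : (forall j, Fit (w j)) ->
  pact (combination w g) f = combination w (fun j => f * g j).
Proof.
move=> Fw; rewrite poly_act_suml //; apply: eq_bigr => j _.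
by rewrite mulrC (poly_actM HA Fit_act_closed).
Qed.

Lemma Fit_combination l (w : 'I_l -> A) g : (forall j, Fit (w j)) -> Fit (combination w g).
Proof.
move=> Fw; have [F0 _ _ _ _] := Fit_act_closed.
rewrite /combination; elim/big_ind: _ => // j _.
exact: (poly_act_closed Fit_act_closed).
Qed.

Lemma combination_act_closed l (w : 'I_l -> A) : (forall j, Fit (w j)) ->
  act_closed brA t (fun x => exists g, x = combination w g).
Proof.
move=> Fw; split.
- by exists (fun=> 0); rewrite /combination big1 // => j _; rewrite poly_act0r.
- by move=> _ _ [g ->] [h ->]; rewrite combinationD; eexists.
- by move=> c _ [g ->]; rewrite combinationZ; eexists.
- move=> _ i [g ->]; exists (fun j => 'X_i * g j).
  by rewrite -poly_act_combination // poly_actXi.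
move=> _ i j [g ->]; case: Fit_act_closed => _ _ _ _; apply; exact: Fit_combination.
Qed.

Lemma combination_delta l (w : 'I_l -> A) j : exists g, w j = combination w g.
Proof.
exists (fun j' => (j' == j)%:R); rewrite /combination (bigD1 j) //= eqxx poly_act1.
by rewrite big1 ?addr0 // => j' /negPf ->; rewrite poly_act0r.
Qed.

(** Generators are the Fit parts of the Lie generators of A and the products of the a_i, which arise
    from bracketing linear parts. *)
Lemma Fit_fin_generated : exists l (w : 'I_l -> A),
  (forall j, Fit (w j)) /\ forall x, Fit x -> exists g, x = combination w g.
Proof.
have [s Hs] := Hfg.
have dec x : exists w, Fit w /\ exists al : 'I_r -> k, x = \sum_i al i *: t i + w.
  by have [al [w [Fw ex]]] := Fit_decomp x; exists w; split=> //; exists al.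
pose fw x := sval (constructive_indefinite_description _ (dec x)).
have fwP x : Fit (fw x) /\ exists al : 'I_r -> k, x = \sum_i al i *: t i + fw x.
  exact: (svalP (constructive_indefinite_description _ (dec x))).
pose ws := [seq fw x | x <- s] ++ [seq brA (t i) (t j) | i <- enum 'I_r, j <- enum 'I_r].
have Fws x : x \in ws -> Fit x.
  rewrite mem_cat => /orP[/mapP[y _ ->]|/allpairsP[[i j] [_ _ ->]]].
    by case: (fwP y).
  exact/square_Fit/in_square_br.
pose w (j : 'I_(size ws)) := ws`_j.
have Fw j : Fit (w j) by apply/Fws/mem_nth.
have Nws x : x \in ws -> exists g, x = combination w g.
  rewrite -index_mem => lt_x; have := combination_delta w (Ordinal lt_x).
  by rewrite /w /= nth_index // -index_mem.
have [N0 ND NZ Nbr _] := combination_act_closed Fw.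
exists (size ws), w; split=> // x Fx.
have [|||al [n [[g ->] ex]]] := generated_decomp HA N0 ND NZ Nbr _ _ Hs _ x.
- by move=> _ _ [g ->] [h ->]; apply: Fit_abelian; apply: Fit_combination.
- by move=> i j; apply: Nws; rewrite mem_cat allpairs_f ?mem_enum ?orbT.
- move=> y /List_In_mem sy; have [_ [al ey]] := fwP y; exists al, (fw y); split=> //.
  by apply: Nws; rewrite mem_cat map_f.
have Fc := Fit_combination g Fw.
exists g; rewrite ex big1 ?add0r // => i _; rewrite (@Fit_lin al) ?scale0r //.
by rewrite -[\sum_i _](addrK (combination w g)) -ex; apply: FitD => //; apply: FitN.
Qed.

(* By Noetherianity the relations between the generators w_j of Fit(A) modulo
   iota(F^2) form a finite system, which Phi'7 solves in F^2 by some u_j; the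
   differences w_j - iota u_j then span a complement of iota(F^2). *)
Lemma square_complement : exists N : A -> Prop,
  [/\ act_closed brA t N, forall x, N x -> Fit x,
      forall c, in_square br c -> N (iota c) -> c = 0 &
      forall x, Fit x -> exists c n, [/\ in_square br c, N n & x = iota c + n]].
Proof.
have [l [w [Fw genw]]] := Fit_fin_generated.
pose rel (v : 'rV[R]_l) c := in_square br c /\ combination w (v 0) = iota c.
have iota_act c f : iota (poly_act br c f a) = pact (iota c) f.
  exact: (lie_hom_poly_act iotaP).
have sq_closed := metabelian_act_closed a brP met.
have combP (w' : 'I_l -> A) (f : R) (u v : 'rV[R]_l) : (forall j, Fit (w' j)) ->
    combination w' ((f *: u + v) 0) = pact (combination w' (u 0)) f + combination w' (v 0).
  move=> Fw'; rewrite poly_act_combination // combinationD.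
  by apply: eq_bigr => j _; rewrite !mxE.
have [|s [sP Hs]] := @submodule_fin_generated k r l (fun v => exists c, rel v c).
  split.
    exists 0; split; first exact: in_square0.
    by rewrite iota0 /combination big1 // => j _; rewrite mxE poly_act0r.
  move=> f u v [c [Vc ec]] [d [Vd ed]]; exists (poly_act br c f a + d); split.
    by apply: in_squareD => //; apply: (poly_act_closed sq_closed).
  by rewrite combP // ec ed iotaD iota_act.
have cdef (i : 'I_(size s)) : exists c, rel s`_i c by apply/sP/mem_nth.
pose c i := sval (constructive_indefinite_description _ (cdef i)).
have cP (i : 'I_(size s)) : rel s`_i (c i) := svalP (constructive_indefinite_description _ (cdef i)).
pose f (i : 'I_(size s)) (j : 'I_l) : R := s`_i 0 j.
have [u [Vu Hu]] : exists u : 'I_l -> F, (forall j, in_square br (u j)) /\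
    forall i, \sum_(j < l) poly_act br (u j) (f i j) a = c i.
  apply: NNPP => nosol.
  have [||i []] := @phi7 (size s) l f c _ nosol w; last first.
  - by have [_ <-] := cP i; rewrite subrr.
  - by move=> j i; apply: Fw.
  by move=> i; case: (cP i).
have Fu j : Fit (iota (u j)) by apply/Fit_iota.
pose w' j := w j - iota (u j).
have Fw' j : Fit (w' j) by apply: FitD => //; apply: FitN.
have combw' g : combination w' g = combination w g - combination (iota \o u) g.
  by rewrite -sumrB; apply: eq_bigr => j _; rewrite poly_actDl // poly_actNl.
have iotau g : iota (\sum_(j < l) poly_act br (u j) (g j) a) = combination (iota \o u) g.
  by rewrite (lie_hom_sum iotaP); apply: eq_bigr => j _; rewrite iota_act.
(* On each generating relation the w_j and the u_j have equal combinations; by linearity every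
   relation kills the differences. *)
have relP v : (exists c, rel v c) -> combination w' (v 0) = 0.
  move=> /Hs /(_ (fun v => combination w' (v 0) = 0)); apply.
    split; first by rewrite /combination big1 // => j _; rewrite mxE poly_act0r.
    by move=> b x y ex ey; rewrite combP // ex ey poly_act0l // addr0.
  move=> y sy; have lt_y : (index y s < size s)%N by rewrite index_mem.
  have := cP (Ordinal lt_y); have := Hu (Ordinal lt_y); rewrite /f /= nth_index // => e [_ ey].
  by rewrite combw' ey -e iotau subrr.
have Vcomb g : in_square br (\sum_(j < l) poly_act br (u j) (g j) a).
  by apply: in_square_sum => j _; apply: (poly_act_closed sq_closed).
exists (fun x => exists g, x = combination w' g); split.
- exact: combination_act_closed.
- by move=> _ [g ->]; apply: Fit_combination.
(* If iota d is a combination of the [w' j], its coefficients form a relation, so the combination is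
   0 and d with it. *)
- move=> d Vd [g eg]; apply: iota_eq0; rewrite eg.
  have gE (w0 : 'I_l -> A) : combination w0 g = combination w0 ((\row_j g j) 0).
    by apply: eq_bigr => j _; rewrite mxE.
  rewrite gE; apply: relP; exists (d + \sum_(j < l) poly_act br (u j) (g j) a).
  split; first exact: in_squareD.
  by rewrite -gE iotaD eg iotau combw' subrK.
move=> x /genw[g ->]; exists (\sum_(j < l) poly_act br (u j) (g j) a), (combination w' g).
by split=> //; [exists g | rewrite iotau combw' addrC subrK].
Qed.

Lemma Phi_extension : exists M : lmodType R, torsion_free M /\
  exists phi : F * M -> A, is_Fr_iso br a brA iota phi.
Proof.
have [N [NP NFit NF Ndec]] := square_complement.
have [M [v [vI vN Nv vD vZ]]] := act_closed_module HA NP.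
have v0 : v 0 = 0 by rewrite -(scale0r (0 : M)) vZ poly_act0r.
have vN1 m : v (- m) = - v m.
  by apply/eqP; rewrite -addr_eq0 -vD addNr v0.
exists M; split=> [f m nzf fm|].
  apply: vI; rewrite v0; apply: (@Fit_torsion_free f) => //; first exact/NFit.
  by rewrite -vZ fm.
pose phi (p : F * M) := iota p.1 + v p.2; exists phi.
have phiD p q : phi (p.1 + q.1, p.2 + q.2) = phi p + phi q.
  by rewrite /phi /= iotaD vD addrACA.
have phi0 p : phi p = 0 -> p = (0, 0).
  case: p => u m; rewrite /phi /= => e.
  have eu : iota u = v (- m) by apply/eqP; rewrite vN1 -addr_eq0 e.
  have u0 : u = 0.
    by apply: NF; [apply/Fit_iota; rewrite eu; apply: NFit | rewrite eu].
  by move: e; rewrite u0 iota0 add0r -v0 => /vI ->.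
have phiI : injective phi.
  move=> [u m] [u' m'] e; have : phi ((u, m).1 + (- u'), (u, m).2 + (- m')) = 0.
    rewrite (phiD (u, m) (- u', - m')) e /phi /= vN1 (lie_homN iotaP).
    by rewrite -opprD subrr.
  by move/phi0 => [/eqP + /eqP]; rewrite !subr_eq0 => /eqP -> /eqP ->.
have phiS x : exists p, phi p = x.
  have [al [w [/Ndec[c [n [_ Nn ->]]] ->]]] := Fit_decomp x.
  have [m em] := Nv n Nn; exists (\sum_i al i *: a i + c, m).
  rewrite /phi /= em iotaD (lie_hom_sum iotaP) addrA; congr (_ + _ + _).
  by apply: eq_bigr => i _; rewrite iotaZ.
split=> //.
- exists (fun x => sval (constructive_indefinite_description _ (phiS x))) => [p|x].
    exact/phiI/(svalP (constructive_indefinite_description _ (phiS (phi p)))).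
  exact: (svalP (constructive_indefinite_description _ (phiS x))).
- by move=> c p; rewrite /phi /= iotaZ vZ poly_actC // scalerDr.
- move=> [u m] [u' m']; rewrite /phi /dme_br /= iota_br vD vN1 !vZ.
  rewrite (brDl HA) !(brDr HA) (Fit_abelian (NFit _ (vN m)) (NFit _ (vN m'))) addr0.
  rewrite (brC HA (iota u) (v m')) (br_Fit_lin_form u (NFit _ (vN m'))).
  rewrite (br_Fit_lin_form u' (NFit _ (vN m))) -addrA; congr (_ + _); exact: addrC.
by move=> u; rewrite /phi /= v0 addr0.
Qed.

End PhiToExtension.

Theorem theorem4p2 (k : finFieldType) (r : nat) (Hr : (2 <= r)%N)
  (F : lmodType k) (brF : F -> F -> F) (a : 'I_r -> F)
  (HF : is_free_metabelian brF a)
  (A : lmodType k) (brA : A -> A -> A) (HA : is_lie brA)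
  (iota : F -> A) (Hiota : is_lie_hom brF brA iota) (Hinj : injective iota)
  (Hmet : metabelian brA) (Hfg : fin_generated brA) :
  (in_ucl brF brA iota <-> Phi'_algebra brF a brA iota) /\
  (Phi'_algebra brF a brA iota <->
     exists (M : lmodType {mpoly k[r]}), torsion_free M /\
       exists phi : F * M -> A, is_Fr_iso brF a brA iota phi).
Proof.
(* The Magnus map comes from the universal property of F, its target being metabelian. *)
have [mu [muP mu_gen]] : exists mu, is_lie_hom brF (@magnus_br k r) mu /\
    forall i, mu (a i) = (delta_mx 0 i, [ffun j => (j == i)%:R]).
  case: HF => _ _ _ univ; exact: (univ _ _ (@magnus_lie k r) (@magnus_metabelian k r)).
have ucl_Phi : in_ucl brF brA iota -> Phi'_algebra brF a brA iota.
  by move/ucl_Phi'_algebra; apply; apply: (free_Phi'_algebra HF Hr muP mu_gen).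
have Phi_ext : Phi'_algebra brF a brA iota -> exists (M : lmodType {mpoly k[r]}),
    torsion_free M /\ exists phi : F * M -> A, is_Fr_iso brF a brA iota phi.
  case=> [[_ phi2 phi3 phi4 phi5] [_ phi7]].
  exact: (Phi_extension HF Hr muP mu_gen HA Hiota Hinj Hmet Hfg).
have ext_ucl : (exists (M : lmodType {mpoly k[r]}), torsion_free M /\
    exists phi : F * M -> A, is_Fr_iso brF a brA iota phi) -> in_ucl brF brA iota.
  move=> [M [tfM [phi phiP]]].
  exact: (extension_in_ucl HF Hr muP mu_gen Hfg tfM phiP).
by split; split=> //; [move/Phi_ext/ext_ucl | move/ext_ucl/ucl_Phi].
Qed.
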